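(* Let $X$ be a smooth projective toric variety with Picard number $\rho(X)\le3$. Then $\mathrm{Nef}(X)$ is unimodular with respect to $\mathrm{Pic}(X)$. Consequently, for every $0\ne D\in\mathrm{Nef}(X)\cap\mathrm{Pic}(X)$, $$\tau_X(D;\mathbb Z)=\tau_X(D;\mathbb Q),\qquad \delta_X(D)=0.$$ In particular, the anticanonical Gongyo indices agree, $\tau_X(\mathbb Z)=\tau_X(\mathbb Q)$, whenever $X$ is weak Fano.
   Context: All toric varieties are over an algebraically closed field. Gongyo indices. For a smooth projective toric variety $X$, a nonzero class $D\in\mathrm{Nef}(X)\cap\mathrm{Pic}(X)$ and $\mathbb K\in\{\mathbb Z,\mathbb Q\}$, put $$\tau_X(D;\mathbb K)=\sup\Big\{\sum_{i=1}^r a_i\ \Big|\ D=\sum_{i=1}^r a_iD_i,\ 0\ne D_i\in\mathrm{Nef}(X)\cap\mathrm{Pic}(X),\ a_i\in\mathbb K_{>0}\Big\}$$ (for $\mathbb K=\mathbb Q$ the equality is in $\mathrm{Pic}(X)\otimes\mathbb Q$), and $\delta_X(D)=\tau_X(D;\mathbb Q)-\tau_X(D;\mathbb Z)$. If $-K_X$ is nef and nonzero, $\tau_X(\mathbb K):=\tau_X(-K_X;\mathbb K)$. A full-dimensional strongly convex rational polyhedral cone $C\subset L_{\mathbb R}$, $L$ a lattice, is unimodular with respect to $L$ if its primitive extremal-ray generators form a $\mathbb Z$-basis of $L$. *)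

(* Defs.v *)
From HB Require Import structures.
From mathcomp Require Import all_boot all_order all_algebra.
From mathcomp Require Import boolp classical_sets reals constructive_ereal ereal.

Set Implicit Arguments.
Unset Strict Implicit.
Unset Printing Implicit Defensive.
Import Order.TTheory GRing.Theory Num.Theory.
Local Open Scope ring_scope.
Local Open Scope quotient_scope.

(* A toric variety of dimension n is given by its fan in N_R, N = Z^n.   *)
(* Row i of [rays X] is the primitive generator u_i of the i-th ray, and *)
(* a cone of the fan is given by the set of indices of its rays.         *)
(* M = Z^n acts on N by the standard scalar product.  The ground field   *)
(* plays no role in the fan, the Picard group or the nef cone.           *)

Record fan (n : nat) := Fan {
  nrays : nat;
  rays : 'M[int]_(nrays, n);
  cones : {set {set 'I_nrays}}
}.

Section Fans.
Variable n : nat.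
Implicit Type X : fan n.

Definition raysK X (K : pzRingType) : 'M[K]_(nrays X, n) :=
  map_mx intr (rays X).

(* divK X K m = sum_i <m, u_i> D_i, the divisor of the character m. *)
Definition divK X (K : pzRingType) (m : 'rV[K]_n) : 'rV[K]_(nrays X) :=
  m *m (raysK X K)^T.

Definition in_cone (R : realType) X (S : {set 'I_(nrays X)}) (v : 'rV[R]_n) :=
  exists c : 'rV[R]_(nrays X),
    [/\ forall i, 0 <= c 0 i, forall i, i \notin S -> c 0 i = 0
      & v = c *m raysK X R].

Definition part_of_basis X (S : {set 'I_(nrays X)}) :=
  exists2 B : 'M[int]_n, B \in unitmx
    & exists2 f : 'I_(nrays X) -> 'I_n, {in S &, injective f}
      & {in S, forall i, row i (rays X) = row (f i) B}.

(* A fan all of whose cones are generated by part of a Z-basis of N; the *)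
(* faces of such a cone are the cones on the subsets of its rays.        *)
Definition smooth_fan (R : realType) X :=
  [/\ forall i, [set i] \in cones X,
      forall S T : {set 'I_(nrays X)},
        S \in cones X -> T \subset S -> T \in cones X,
      forall S, S \in cones X -> part_of_basis S
    & forall S T, S \in cones X -> T \in cones X ->
        forall v : 'rV[R]_n,
          in_cone S v -> in_cone T v -> in_cone (S :&: T) v].

Definition complete_fan (R : realType) X :=
  forall v : 'rV[R]_n, exists2 S, S \in cones X & in_cone S v.

Definition max_cone X (S : {set 'I_(nrays X)}) := (S \in cones X) && (#|S| == n).

(* The support function of the divisor with coefficients D is strictly   *)
(* convex; m is the Cartier datum of the divisor on the cone S.          *)
Definition ample_divisor X (D : 'rV[int]_(nrays X)) :=
  forall S, max_cone S -> exists m : 'rV[int]_n,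
    forall i, if i \in S then divK X m 0 i = - D 0 i
              else - D 0 i < divK X m 0 i.

Definition smooth_projective (R : realType) X :=
  [/\ smooth_fan R X, complete_fan R X & exists D, @ample_divisor X D].

(* Pic X K is Pic(X) (x) K, that is K^(rays) / (M (x) K).                *)
Section Pic.
Variables (X : fan n) (K : comNzRingType).

Definition principal : {pred 'rV[K]_(nrays X)} :=
  [pred D | `[< exists m : 'rV[K]_n, D = divK X m >]].

Lemma principal_zmod_closed : zmod_closed principal.
Proof.
split; first by apply/asboolP; exists 0; rewrite /divK mul0mx.
move=> _ _ /asboolP[m ->] /asboolP[m' ->]; apply/asboolP.
by exists (m - m'); rewrite /divK mulmxBl.
Qed.

HB.instance Definition _ :=
  GRing.isZmodClosed.Build 'rV[K]_(nrays X) principal principal_zmod_closed.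

Definition Pic := Quotient.quot principal.

HB.instance Definition _ := GRing.Zmodule.on Pic.
HB.instance Definition _ := EqQuotient.on Pic.

Definition cl (D : 'rV[K]_(nrays X)) : Pic := \pi_Pic D.

Lemma cl_eq D D' : cl D = cl D' <-> exists m, D - D' = divK X m.
Proof.
split=> [/eqP|[m DD']].
  by rewrite /cl eqmodE /= => /asboolP.
by apply/eqP; rewrite /cl eqmodE; apply/asboolP; exists m.
Qed.

Lemma repr_cl c : cl (repr c) = c. Proof. exact: reprK. Qed.

Lemma clD D D' : cl (D + D') = cl D + cl D'.
Proof. exact: (@Quotient.pi_add _ principal). Qed.

Definition scale_pic (a : K) (c : Pic) : Pic := cl (a *: repr c).

Lemma scale_cl a D : scale_pic a (cl D) = cl (a *: D).
Proof.
apply/cl_eq; have /cl_eq[m DE] := repr_cl (cl D).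
by exists (a *: m); rewrite -scalerBr DE /divK scalemxAl.
Qed.

Lemma scale_picA a b c : scale_pic a (scale_pic b c) = scale_pic (a * b) c.
Proof. by rewrite -[c]repr_cl !scale_cl scalerA. Qed.

Lemma scale_pic1 : left_id 1 scale_pic.
Proof. by move=> c; rewrite -[c]repr_cl scale_cl scale1r. Qed.

Lemma scale_picDr : right_distributive scale_pic +%R.
Proof.
move=> a c d; rewrite -[c]repr_cl -[d]repr_cl -clD !scale_cl -clD.
by rewrite scalerDr.
Qed.

Lemma scale_picDl c : {morph scale_pic^~ c : a b / a + b}.
Proof. by move=> a b; rewrite -[c]repr_cl !scale_cl -clD scalerDl. Qed.

HB.instance Definition _ := GRing.Zmodule_isLmodule.Build K Pic
  scale_picA scale_pic1 scale_picDr scale_picDl.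

End Pic.

(* The base change Pic(X) -> Pic(X) (x) K. *)
Definition pic_map X (K : comNzRingType) (c : Pic X int) : Pic X K :=
  cl (map_mx intr (repr c)).

Lemma pic_map_cl X (K : comNzRingType) D :
  pic_map K (cl D : Pic X int) = cl (map_mx intr D).
Proof.
apply/cl_eq; have /cl_eq[m DE] := repr_cl (cl D : Pic X int).
exists (map_mx intr m); rewrite -map_mxB DE /divK map_mxM; congr (_ *m _).
by apply/matrixP=> i j; rewrite !mxE intz.
Qed.

(* [invariant_curve X b]: b is the vector of the D_i . C, where C is the *)
(* closure of the orbit of a codimension-one cone S :&: T.  D_i . C is 1 *)
(* on the two rays off the wall, 0 if the ray spans no cone with the     *)
(* wall, and sum_i (D_i . C) u_i = 0 as principal divisors have degree 0 *)
(* on C; this determines b.                                              *)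
Definition invariant_curve X (b : 'rV[int]_(nrays X)) :=
  exists S T, [/\ max_cone S, max_cone T & #|S :&: T|.+1 = n] /\
    [/\ b *m rays X = 0,
        forall i, i \in (S :\: T) :|: (T :\: S) -> b 0 i = 1
      & forall i, i \notin S :|: T -> b 0 i = 0].

Definition dot X (K : comNzRingType) (D : 'rV[K]_(nrays X))
  (b : 'rV[int]_(nrays X)) : K := \sum_i D 0 i * (b 0 i)%:~R.

Definition intersection X (K : comNzRingType) (c : Pic X K)
  (b : 'rV[int]_(nrays X)) : K := dot (repr c) b.

Lemma intersection_cl X (K : comNzRingType) (D : 'rV[K]_(nrays X)) b :
  b *m rays X = 0 -> intersection (cl D) b = dot D b.
Proof.
move=> b0; have /cl_eq[m DE] := repr_cl (cl D).
have dotE (E : 'rV[K]_(nrays X)) : dot E b = (E *m (map_mx intr b)^T) 0 0.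
  by rewrite mxE; apply: eq_bigr => i _; rewrite !mxE.
apply/eqP; rewrite /intersection -subr_eq0 !dotE.
have -> (A B : 'M[K]_1) : A 0 0 - B 0 0 = (A - B) 0 0 by rewrite !mxE.
rewrite -mulmxBl DE /divK -mulmxA -trmx_mul /raysK -map_mxM b0.
by rewrite map_mx0 trmx0 mulmx0 mxE.
Qed.

Definition Nef (R : realType) X : set (Pic X R) :=
  [set c | forall b, invariant_curve b -> 0 <= intersection c b].

Definition nef (R : realType) X (c : Pic X int) : Prop :=
  @Nef R X (pic_map R c).

(* -K_X = sum_i D_i *)
Definition antican_divisor X : 'rV[int]_(nrays X) := const_mx 1.
Definition antican X : Pic X int := cl (antican_divisor X).

(* h^0(X, O(D)) >= k: the characters chi^m with div(chi^m) + D >= 0 form *)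
(* a basis of H^0(X, O(D)).                                              *)
Definition h0_ge X (D : 'rV[int]_(nrays X)) (k : nat) :=
  exists s : seq 'rV[int]_n,
    [/\ uniq s, size s = k
      & {in s, forall m : 'rV[int]_n, forall i, 0 <= divK X m 0 i + D 0 i}].

Definition big_divisor (R : realType) X (D : 'rV[int]_(nrays X)) :=
  exists2 eps : R, 0 < eps & exists k0 : nat, forall k, (k0 <= k)%N ->
    exists2 h : nat, h0_ge (D *+ k) h & eps * k%:R ^+ n <= h%:R.

Definition weak_fano (R : realType) X :=
  nef R (antican X) /\ big_divisor R (antican_divisor X).

Definition decompositionsZ (R : realType) X (D : Pic X int) : set (\bar R) :=
  [set x | exists (r : nat) (a : 'I_r -> int) (E : 'I_r -> Pic X int),
    [/\ forall i, E i != 0 /\ nef R (E i), forall i, 0 < a i,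
        D = \sum_i E i *~ a i & x = ((\sum_i a i)%:~R)%:E]].

Definition decompositionsQ (R : realType) X (D : Pic X int) : set (\bar R) :=
  [set x | exists (r : nat) (a : 'I_r -> rat) (E : 'I_r -> Pic X int),
    [/\ forall i, E i != 0 /\ nef R (E i), forall i, 0 < a i,
        pic_map rat D = \sum_i a i *: pic_map rat (E i)
      & x = (ratr (\sum_i a i))%:E]].

Definition tauZ (R : realType) X (D : Pic X int) : \bar R :=
  ereal_sup (@decompositionsZ R X D).
Definition tauQ (R : realType) X (D : Pic X int) : \bar R :=
  ereal_sup (@decompositionsQ R X D).
Definition delta (R : realType) X (D : Pic X int) : \bar R :=
  (tauQ R D - tauZ R D)%E.

End Fans.

Definition Zbasis (L : zmodType) (d : nat) (b : 'I_d -> L) :=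
  forall x, exists! z : 'rV[int]_d, x = \sum_i b i *~ z 0 i.

Definition has_rank (L : zmodType) (d : nat) := exists b : 'I_d -> L, Zbasis b.

Section Cones.
Variables (R : realType) (L : zmodType) (V : lmodType R) (iota : L -> V).
Variable C : set V.

Definition rational_polyhedral :=
  exists (k : nat) (g : 'I_k -> L), forall v : V,
    C v <-> exists2 c : 'I_k -> R, forall i, 0 <= c i
              & v = \sum_i c i *: iota (g i).

Definition strongly_convex := forall v : V, C v -> C (- v) -> v = 0.

Definition full_dimensional :=
  forall v : V, exists x y : V, [/\ C x, C y & v = x - y].

Definition on_extremal_ray (v : V) :=
  [/\ C v, v != 0
    & forall x y : V, C x -> C y -> v = x + y ->
        exists2 t : R, 0 <= t & x = t *: v].

Definition primitive (g : L) :=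
  g != 0 /\ forall (h : L) (k : nat), g = h *+ k -> k = 1%N.

Definition unimodular :=
  [/\ full_dimensional, strongly_convex, rational_polyhedral
    & exists (d : nat) (b : 'I_d -> L), Zbasis b /\
        forall g, (exists i, g = b i) <->
                  primitive g /\ on_extremal_ray (iota g)].

End Cones.

(* Main.v *)
Require Import Defs.
From mathcomp Require Import boolp classical_sets reals constructive_ereal ereal.
From mathcomp Require Import all_boot all_order all_algebra.
From mathcomp Require Import zify ring lra polyrcf.

(** The idea is to work in the Gale dual of the fan.  Let d_i in Pic(X) = Z^rho
be the class of D_i, and let a be an ample class.  For a maximal cone S the
complement T of S has rho elements, the d_i with i in T form a Z-basis of
Pic(X), and a lies in the open simplicial cone that they span; conversely, if a
is a nonnegative combination of some of the d_i, then these contain such a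
basis.  The nef cone is the intersection of these simplicial cones, and the
invariant curves are the functionals that vanish on rho - 1 members of a basis
and have value 1 on the two vectors that complete them to bases.  The claim
thus becomes: if all simplices of a vector configuration that contain a are
unimodular and rho <= 3, then their intersection is a unimodular cone
([config_unimodular]).

Among the nonzero integral functionals phi >= 0 on all d_i take one with phi(a)
minimal.  A comparison with a primitive relation shows that phi has value 1 on
the members of a set P and 0 elsewhere ([fibration_ex]): X is generically
fibred in projective spaces over a toric variety of smaller Picard number, with
P the rays of the fibre.

If every basis meets P in one element, X is a projective bundle over a toric
variety of Picard number rho - 1: the bases are the sets p |: tau, with p in P
and tau a basis of the base.  The facets of the nef cone of the base lift to X,
normalised by the largest value on P, and phi is the one further facet
([bundle_lift]); induction applies.

Otherwise some basis contains p <> q in P and some v outside P, and rho = 3.  In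
the affine plane phi = 1 the members of P are lattice points, the others are
directions, and unimodularity leaves only three directions (1,0), (0,1), (-1,1)
and two vertical lines x = 0 and x = 1 for the points.  The nef cone can then be
written down ([plane_nef]).

Each facet that occurs is the class of an invariant curve, and each generator
lies in the cone of every basis, so the argument never needs that local
convexity implies global convexity.

Once Nef(X) is the cone on a Z-basis, the sum of the coordinates is a functional
that is at least 1 on every nonzero nef class, so it bounds both Gongyo indices,
and the decomposition of D along the basis attains it ([tau_sum]). *)

Set Implicit Arguments.
Unset Strict Implicit.
Unset Printing Implicit Defensive.
Import Order.TTheory GRing.Theory Num.Theory.
Local Open Scope ring_scope.

(** * Vector configurations with a chamber *)

Definition supported N (T : {set 'I_N}) (c : 'rV[int]_N) :=
  forall i, i \notin T -> c 0 i = 0.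

(** The rows of G are the vectors d_i; phi is a functional, so that
[ev G phi] lists its values on the d_i.  When G is the Gale dual of a fan these
lists are the linear relations between the rays. *)
Definition ev N d (G : 'M[int]_(N, d)) (phi : 'cV[int]_d) (i : 'I_N) : int :=
  (G *m phi) i 0.

Lemma col_mulmx m n p (A : 'M[int]_(m, n)) (C : 'M[int]_(n, p)) j :
  col j (A *m C) = A *m col j C.
Proof. by rewrite !colE mulmxA. Qed.

Lemma ev_col N d p (G : 'M[int]_(N, d)) (A : 'M[int]_(d, p)) l i :
  ev G (col l A) i = (G *m A) i l.
Proof. by rewrite /ev -col_mulmx mxE. Qed.

(** B is the family of bases whose open cone contains a; V is the set of indices
in use, which lets the base of a bundle keep the indices of the total space.
[basis_span] and [basis_dual] say together that a basis of B is a Z-basis.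
[completeness] is linear programming duality for the minimum of sum_i z_i c_i
over the c >= 0 with c *m G = a, attained at a vertex: in the fan it says that
the vector sum_i z_i u_i lies in some maximal cone.  [basis_avoid] says that
each u_i is a ray of the fan. *)
Record gale_config N d (V : {set 'I_N}) (G : 'M[int]_(N, d)) (a : 'rV[int]_d)
    (B : {set {set 'I_N}}) : Prop := GaleConfig {
  basis_sub : forall T, T \in B -> T \subset V;
  basis_span : forall T w, T \in B ->
    exists2 c : 'rV_N, supported T c & w = c *m G;
  basis_dual : forall T (z : 'I_N -> int), T \in B ->
    exists phi : 'cV_d, {in T, forall i, ev G phi i = z i};
  basis_ample : forall T, T \in B ->
    exists c : 'rV_N, [/\ supported T c, {in T, forall i, 0 < c 0 i}
                        & a = c *m G];
  completeness : forall z : 'I_N -> int, exists T phi,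
    [/\ T \in B, {in V, forall i, ev G phi i <= z i}
      & {in T, forall i, ev G phi i = z i}];
  basis_avoid : forall i, i \in V -> exists2 T, T \in B & i \notin T }.

(** For the Gale dual of a fan these are the classes of the invariant curves. *)
Definition wall N d (G : 'M[int]_(N, d)) (B : {set {set 'I_N}})
    (phi : 'cV[int]_d) :=
  exists (tau : {set 'I_N}) (i j : 'I_N),
    [/\ [/\ i \notin tau, j \notin tau & i != j],
        i |: tau \in B, j |: tau \in B, {in tau, forall k, ev G phi k = 0}
      & ev G phi i = 1 /\ ev G phi j = 1].

Definition in_cone_of N d (G : 'M[int]_(N, d)) (T : {set 'I_N})
    (w : 'rV[int]_d) :=
  exists c : 'rV_N, [/\ supported T c, forall i, 0 <= c 0 i & w = c *m G].

(** W lists generators of the nef cone and F its facets.  That the facets are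
walls bounds the nef cone from outside, that the generators lie in all the
simplicial cones bounds it from inside. *)
Definition unimodular_config N d (G : 'M[int]_(N, d)) (B : {set {set 'I_N}}) :=
  exists F W : 'M[int]_d, [/\ W *m F = 1%:M, forall k, wall G B (col k F)
    & forall k T, T \in B -> in_cone_of G T (row k W)].

Section Config.
Variables (N d : nat) (V : {set 'I_N}) (G : 'M[int]_(N, d)) (a : 'rV[int]_d).
Variable B : {set {set 'I_N}}.
Hypothesis cfg : gale_config V G a B.

Lemma eval_comb (c : 'rV_N) (phi : 'cV_d) :
  (c *m G *m phi) 0 0 = \sum_i c 0 i * ev G phi i.
Proof. by rewrite -mulmxA mxE. Qed.

Lemma eval_supp T (c : 'rV_N) (phi : 'cV_d) : supported T c ->
  (c *m G *m phi) 0 0 = \sum_(i in T) c 0 i * ev G phi i.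
Proof.
move=> sc; rewrite eval_comb (bigID (mem T)) /= [X in _ + X]big1 ?addr0 //.
by move=> i /sc ->; rewrite mul0r.
Qed.

Lemma evN phi i : ev G (- phi) i = - ev G phi i.
Proof. by rewrite /ev mulmxN !mxE. Qed.

Lemma evD phi psi i : ev G (phi + psi) i = ev G phi i + ev G psi i.
Proof. by rewrite /ev mulmxDr !mxE. Qed.

Lemma evZ c phi i : ev G (c *: phi) i = c * ev G phi i.
Proof. by rewrite /ev -scalemxAr !mxE. Qed.

Lemma evB phi psi i : ev G (phi - psi) i = ev G phi i - ev G psi i.
Proof. by rewrite /ev mulmxBr !mxE. Qed.

Lemma basis_inj T phi : T \in B -> {in T, forall i, ev G phi i = 0} -> phi = 0.
Proof.
move=> TB phi0; apply/matrixP=> k j; rewrite ord1 {j}.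
have [c sc Ec] := basis_span cfg (delta_mx 0 k : 'rV_d) TB.
have := eval_supp phi sc; rewrite -Ec -rowE !mxE => ->.
by apply: big1 => i iT; rewrite phi0 // mulr0.
Qed.

Lemma basis_card T : T \in B -> #|T| = d.
Proof.
move=> TB.
pose f : 'I_#|T| -> 'I_N := enum_val.
have /fin_all_exists[C CE] : forall k, exists c : 'rV[int]_N,
    supported T c /\ delta_mx 0 k = c *m G.
  move=> k.
  by have [c ? ?] := basis_span cfg (delta_mx 0 k : 'rV_d) TB; exists c.
have /fin_all_exists[H HE] : forall k, exists phi : 'cV[int]_d,
    forall j, ev G phi (f j) = (j == k)%:R.
  move=> k.
  have [phi phiE] := basis_dual cfg (fun i => (i == f k)%:R) TB.
  exists phi => j; rewrite phiE ?enum_valP //.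
  by rewrite (inj_eq enum_val_inj).
pose GT : 'M[int]_(#|T|, d) := \matrix_(j, k) G (f j) k.
have e1 : (\matrix_(k, j) C k 0 (f j)) *m GT = 1%:M.
  apply/matrixP=> k l; rewrite !mxE.
  have [sc /matrixP/(_ 0 l)] := CE k; rewrite !mxE eqxx /= eq_sym => ->.
  rewrite [RHS](bigID (mem T)) /= [X in _ = _ + X]big1 ?addr0; last first.
    by move=> i /sc ->; rewrite mul0r.
  rewrite [RHS]big_enum_val /=; apply: eq_bigr => j _; by rewrite !mxE.
have e2 : GT *m (\matrix_(l, k) H k l 0) = 1%:M.
  apply/matrixP=> j k; rewrite !mxE -HE /ev mxE.
  by apply: eq_bigr => l _; rewrite !mxE.
by apply/eqP; rewrite eqn_leq (mulmx1_min e1) (mulmx1_min e2).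
Qed.

Lemma functional_eq T phi psi : T \in B ->
  {in T, forall i, ev G phi i = ev G psi i} -> phi = psi.
Proof.
move=> TB e; apply/eqP; rewrite -subr_eq0; apply/eqP/(basis_inj TB) => i iT.
by rewrite evB e // subrr.
Qed.

Lemma basis_ex : exists T, T \in B.
Proof. by have [T [_ [TB _ _]]] := completeness cfg (fun=> 0); exists T. Qed.

(** Completeness for the constant -1: in the fan, minus the sum of the rays lies
in a cone, which gives a strictly positive relation. *)
Lemma positive_functional : exists psi, {in V, forall i, 0 < ev G psi i}.
Proof.
have [T [phi [_ le _]]] := completeness cfg (fun=> -1).
by exists (- phi) => i /le; rewrite evN; lia.
Qed.

(** a is a positive combination of a basis. *)
Lemma eval_ample_ge0 phi : {in V, forall i, 0 <= ev G phi i} ->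
  0 <= (a *m phi) 0 0 /\ ((a *m phi) 0 0 = 0 -> phi = 0).
Proof.
move=> ge0; have [T TB] := basis_ex.
have [c [sc cpos ->]] := basis_ample cfg TB; rewrite (eval_supp _ sc).
have ge0T i : i \in T -> 0 <= c 0 i * ev G phi i.
  by move=> iT; rewrite mulr_ge0 ?(ltW (cpos _ _)) ?ge0 //
    (subsetP (basis_sub cfg TB)).
split=> [|/eqP]; first by apply: sumr_ge0.
rewrite psumr_eq0 // => /allP e0.
apply: (basis_inj TB) => i iT; have := e0 i (mem_index_enum i).
by rewrite iT /= mulf_eq0 (gt_eqF (cpos _ iT)) /= => /eqP.
Qed.

(** Completeness is applied to the indicator z of the complement of the support
of c.  Its solution phi has k phi(a) <= 0 by the expansion c, and phi(a) >= 0 by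
the expansion of a along the basis T, on which phi = z; so z vanishes on T. *)
Lemma basis_in_support (c : 'rV_N) (k : int) : 0 < k -> supported V c ->
  (forall i, 0 <= c 0 i) -> c *m G = k *: a ->
  exists2 T, T \in B & {in T, forall i, 0 < c 0 i}.
Proof.
move=> k0 sc cge cG.
have [T [phi [TB le eqT]]] := completeness cfg (fun i => (c 0 i == 0)%:R).
exists T => // i iT; rewrite lt_neqAle cge eq_sym andbT.
have [e [se epos aE]] := basis_ample cfg TB.
have ub : k * (a *m phi) 0 0 <= 0.
  have -> : k * (a *m phi) 0 0 = (c *m G *m phi) 0 0
    by rewrite cG -scalemxAl [RHS]mxE.
  rewrite (eval_supp _ sc); apply: sumr_le0 => j /le.
  have := cge j; case: eqP => [-> _ _|_ cj lej]; first by rewrite mul0r.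
  by rewrite mulr_ge0_le0.
have lb : e 0 i * (c 0 i == 0)%:R <= (a *m phi) 0 0.
  rewrite aE (eval_supp _ se) (bigD1 i) //= eqT // lerDl.
  apply: sumr_ge0 => j /andP[jT _].
  by rewrite eqT // mulr_ge0 ?ler0n // ltW ?epos.
apply: contraTneq isT => ci0; move: lb; rewrite ci0 eqxx mulr1.
have := epos i iT; nia.
Qed.

End Config.

(** * A fibration with linear fibres *)

Section Fibration.

Variables (N d : nat) (V : {set 'I_N}) (G : 'M[int]_(N, d)) (a : 'rV[int]_d).
Variable B : {set {set 'I_N}}.
Hypothesis cfg : gale_config V G a B.

(** A primitive collection P whose rays have sum zero. *)
Definition fibration (P : {set 'I_N}) (phi : 'cV[int]_d) :=
  [/\ P \subset V, {in V, forall i, ev G phi i = (i \in P)%:R}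
    & forall p, p \in P -> exists2 T, T \in B & T :&: P = [set p]].

Lemma minimal_functional : (0 < d)%N -> exists phi,
  [/\ phi != 0, {in V, forall i, 0 <= ev G phi i}
    & forall psi, {in V, forall i, 0 <= ev G psi i} ->
        (a *m psi) 0 0 < (a *m phi) 0 0 -> psi = 0].
Proof.
move=> d0; pose Q (k : nat) := `[< exists phi : 'cV_d,
  [/\ phi != 0, {in V, forall i, 0 <= ev G phi i} & (a *m phi) 0 0 = k%:Z] >].
have exQ : exists k, Q k.
  have [psi psi0] := positive_functional cfg.
  have ge0 : {in V, forall i, 0 <= ev G psi i} by move=> i /psi0/ltW.
  have [a0 _] := eval_ample_ge0 cfg ge0.
  exists (absz ((a *m psi) 0 0)); apply/asboolP; exists psi; split=> //;
    last lia.
  have [T TB] := basis_ex cfg.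
  have /card_gt0P[i iT] : (0 < #|T|)%N by rewrite (basis_card cfg TB).
  apply/eqP=> psi_0; have := psi0 i (subsetP (basis_sub cfg TB) i iT).
  by rewrite psi_0 /ev mulmx0 mxE.
case: (ex_minnP exQ) => k /asboolP[phi [phi0 ge0 phik]] kmin.
exists phi; split=> // psi psi_ge0 lt;
  have [a0 _] := eval_ample_ge0 cfg psi_ge0.
apply/eqP/negPn/negP => psi0; have := kmin (absz ((a *m psi) 0 0)).
have -> : Q (absz ((a *m psi) 0 0)) by apply/asboolP; exists psi; split=> //;
  lia.
by move=> /(_ isT); lia.
Qed.

(** Let phi be minimal, and let P be a minimal set that meets all bases and is
contained in the support of phi.  Completeness for the indicator of P gives a
functional psi <= 1_P with psi(a) > 0: it is the primitive relation of P.  Since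
phi is integral, phi >= 1_P >= psi, so phi - psi is nonnegative and smaller on
a; it is zero by minimality, which squeezes phi to 1_P. *)
Lemma fibration_ex : (0 < d)%N ->
  exists P, exists2 phi, fibration P phi & P != finset.set0.
Proof.
move=> /minimal_functional[phi [phi0 phi_ge0 phi_min]].
pose hits (P : {set 'I_N}) := [forall T in B, T :&: P != finset.set0].
pose S := [set i in V | ev G phi i != 0].
have hitS : hits S.
  apply/'forall_implyP => T TB; apply/negP => /eqP TS0.
  case/eqP: phi0; apply: (basis_inj cfg TB) => i iT.
  apply/eqP/negPn/negP => n0; have : i \in T :&: S.
    by rewrite !inE iT n0 (subsetP (basis_sub cfg TB)).
  by rewrite TS0 inE.
have [P /minsetP[hitP Pmin] PS] := minset_exists hitS.
have PV : P \subset V by apply: subset_trans PS _; apply/subsetP=> i;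
  rewrite inE => /andP[].
have Psing p : p \in P -> exists2 T, T \in B & T :&: P = [set p].
  move=> pP; have : ~~ hits (P :\ p).
    apply/negP => /Pmin -/(_ (subsetDl _ _)) e.
    by move: pP; rewrite -e !inE eqxx.
  rewrite negb_forall => /existsP[T];
    rewrite negb_imply negbK => /andP[TB /eqP e].
  exists T => //.
  have /'forall_implyP/(_ T TB)/set0Pn[q] := hitP.
  rewrite inE => /andP[qT qP]; apply/setP=> i.
  have noti j : j \in T -> j \in P -> j = p.
    move=> jT jP; apply/eqP/negPn/negP => jp.
    by have := in_set0 j; rewrite -e !inE jT jP jp.
  rewrite !inE; apply/andP/eqP => [[] /noti //|->]; by rewrite -(noti q).
have P0 : P != finset.set0.
  have [T TB] := basis_ex cfg; have /'forall_implyP/(_ T TB)/set0Pn[q] := hitP.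
  by rewrite inE => /andP[_ qP]; apply/set0Pn; exists q.
exists P, phi => //; split => // i iV.
(* psi is the primitive relation of P. *)
have [T [psi [TB le eqT]]] := completeness cfg (fun i => (i \in P)%:R).
have diff_ge0 : {in V, forall i, (i \in P)%:R <= ev G phi i}.
  move=> j jV; have [/(subsetP PS)|_] := boolP (j \in P); last exact: phi_ge0.
  by rewrite inE => /andP[_]; have := phi_ge0 j jV; lia.
have /eqP : phi - psi = 0.
  apply: phi_min => [j jV|].
    by rewrite evB subr_ge0 (le_trans (le j jV)) ?diff_ge0.
  rewrite mulmxBr [X in X < _]mxE [(- _ : 'M__) 0 0]mxE gtrDl oppr_lt0.
  have [c [sc cpos ->]] := basis_ample cfg TB; rewrite (eval_supp _ _ sc).
  have /'forall_implyP/(_ T TB)/set0Pn[q] := hitP.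
  rewrite inE => /andP[qT qP]; rewrite (bigD1 q) //= eqT // qP mulr1.
  apply: ltr_wpDr; last exact: cpos.
  apply: sumr_ge0 => j /andP[jT _].
  by rewrite eqT // mulr_ge0 ?ler0n // ltW ?cpos.
rewrite subr_eq0 => /eqP e.
by apply/eqP; rewrite eq_le diff_ge0 // andbT e le.
Qed.

Lemma fibration_meets P phi T : fibration P phi -> P != finset.set0 ->
  T \in B ->
  exists2 p, p \in P & p \in T.
Proof.
case=> PV phiE _ /set0Pn[q qP] TB.
have [/existsP[p /andP[]]|] := boolP [exists p in P, p \in T];
  first by exists p.
rewrite negb_exists => /forallP h; suff phi0 : phi = 0.
  by have := phiE q (subsetP PV q qP); rewrite qP phi0 /ev mulmx0 mxE.
apply: (basis_inj cfg TB) => i iT;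
  rewrite phiE ?(subsetP (basis_sub cfg TB)) //.
by have := h i; rewrite iT andbT => /negPf ->.
Qed.

(** The pivot rule of the simplex method: d_i is expanded along T, and the
leaving index k minimises the ratio of the coefficients of a and d_i.  Some
coefficient of d_i is positive because of the positive functional. *)
Lemma exchange T i : T \in B -> i \in V -> i \notin T ->
  exists2 k, k \in T & i |: (T :\ k) \in B.
Proof.
move=> TB iV iT.
have [x sx xE] := basis_span cfg (delta_mx 0 i *m G) TB.
have [e [se epos eE]] := basis_ample cfg TB.
have TV := subsetP (basis_sub cfg TB).
have [j0 j0T xj0] : exists2 j, j \in T & 0 < x 0 j.
  have [psi psi0] := positive_functional cfg.
  apply/exists_inP; have [//|] := boolP [exists j in T, 0 < x 0 j].
  rewrite negb_exists => /forallP h.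
  have := psi0 i iV; rewrite ltNge; case/negP.
  have -> : ev G psi i = ((delta_mx 0 i : 'rV_N) *m G *m psi) 0 0.
    by rewrite -mulmxA -rowE mxE.
  rewrite xE (eval_supp _ _ sx); apply: sumr_le0 => j jT.
  have := h j; rewrite jT /= -leNgt => xj.
  by rewrite mulr_le0_ge0 // ltW // psi0 // TV.
pose ratio j : rat := (e 0 j)%:~R / (x 0 j)%:~R.
pose pos := [pred j | (j \in T) && (0 < x 0 j)].
have Pj0 : pos j0 by rewrite /= j0T.
case: (arg_minP ratio Pj0) => k /andP[kT xk] kmin.
exists k => //.
have crossle j : e 0 k * x 0 j <= e 0 j * x 0 k.
  have [jT|jT] := boolP (j \in T);
    last by rewrite (sx j jT) (se j jT) mulr0 mul0r.
  have [xj|xj] := ltP 0 (x 0 j).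
    have := kmin j; rewrite /= jT xj => /(_ isT).
    rewrite /ratio ler_pdivrMr ?ltr0z // mulrAC ler_pdivlMr ?ltr0z //.
    by rewrite -!intrM ler_int.
  by have := epos _ jT; have := epos _ kT; nia.
pose c : 'rV_N := x 0 k *: e - e 0 k *: x + e 0 k *: delta_mx 0 i.
have cE j : c 0 j = x 0 k * e 0 j - e 0 k * x 0 j + e 0 k * (j == i)%:R.
  by rewrite !mxE.
have [] := basis_in_support cfg (c := c) xk.
- move=> j jV; have jT : j \notin T by apply: contra jV; apply: TV.
  by rewrite cE (se j jT) (sx j jT)
    (_ : j == i = false) ?mulr0 ?subr0 ?addr0 //; apply: contraNF jV => /eqP ->.
- move=> j; rewrite cE; have := crossle j; have := epos _ kT.
  by case: (j == i); nia.
- by rewrite mulmxDl mulmxBl -!scalemxAl -eE -xE subrK.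
move=> T' T'B cpos; suff <- : T' = i |: (T :\ k) by [].
apply/eqP; rewrite eqEcard; apply/andP; split.
  apply/subsetP => j jT'; have := cpos j jT'; rewrite cE !inE.
  case: eqP => //= ji; case: eqP => [->|_] /=; first by lia.
  by apply: contraTT => jT; rewrite (se j jT) (sx j jT); lia.
rewrite cardsU1 !inE (negPf iT) andbF (basis_card cfg T'B).
by have := basis_card cfg TB; rewrite (cardsD1 k) kT => ->.
Qed.

End Fibration.

(** * Projective bundles *)

Section Bundle.
Variables (N d : nat) (V : {set 'I_N}) (G : 'M[int]_(N, d.+1))
  (a : 'rV[int]_d.+1).
Variable B : {set {set 'I_N}}.
Hypothesis cfg : gale_config V G a B.
Variables (P : {set 'I_N}) (phi : 'cV[int]_d.+1).
Hypothesis fib : fibration V G B P phi.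
Hypothesis meets_once : forall T, T \in B -> exists p, T :&: P = [set p].

(** The exchange of p into T must remove the only element of T in P. *)
Lemma bundle_fibre T p : T \in B -> p \in P -> p |: (T :\: P) \in B.
Proof.
move=> TB pP; have [q Tq] := meets_once TB.
have qTP : q \in T :&: P by rewrite Tq set11.
have TE : T :\: P = T :\ q by rewrite -Tq setDIr setDv set0U.
have [pT|pT] := boolP (p \in T).
  have : p \in T :&: P by rewrite inE pT.
  by rewrite Tq inE => /eqP ->; rewrite TE setD1K //; case/setIP: qTP.
have pV : p \in V by have [/subsetP PV _ _] := fib; exact: PV.
have [k kT T'B] := exchange cfg TB pV pT.
have [r T'r] := meets_once T'B.
suff kq : k = q by rewrite TE -kq.
apply/eqP/negPn/negP => kq; case/setIP: qTP => qT qP.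
have : q \in (p |: T :\ k) :&: P by rewrite !inE qT qP (eq_sym q k) kq orbT.
have : p \in (p |: T :\ k) :&: P by rewrite !inE eqxx pP.
rewrite T'r !inE => /eqP <- /eqP qp; by rewrite -qp qT in pT.
Qed.

(** Splitting Z^(d+1) as the kernel of phi plus the line of d_p0, for
p0 \in P: the rows of Gam are the other members of a basis through p0, and
Phi is the projection to their coordinates. *)
Lemma bundle_coordinates p0 : p0 \in P ->
  exists (Phi : 'M[int]_(d.+1, d)) (Gam : 'M[int]_(d, d.+1)),
  [/\ Gam *m Phi = 1%:M, Gam *m phi = 0, row p0 G *m Phi = 0
    & Phi *m Gam + phi *m row p0 G = 1%:M].
Proof.
move=> p0P; have [PV phiE fibP] := fib.
have [T0 T0B T0P] := fibP _ p0P.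
have p0T : p0 \in T0 by have := set11 p0; rewrite -T0P => /setIP[].
have card_tau : #|T0 :\ p0| = d.
  by have := basis_card cfg T0B; rewrite (cardsD1 p0) p0T => -[].
pose e (k : 'I_d) : 'I_N := enum_val (cast_ord (esym card_tau) k).
have e_inj : injective e by move=> k l /enum_val_inj/cast_ord_inj.
have e_in k : e k \in T0 :\ p0 by apply: enum_valP.
have e_onto i : i \in T0 -> i != p0 -> exists k, i = e k.
  move=> iT ip; have iT' : i \in T0 :\ p0 by rewrite !inE ip.
  exists (cast_ord card_tau (enum_rank_in iT' i)).
  by rewrite /e cast_ordK enum_rankK_in.
have eT k : e k \in T0 by have := e_in k; rewrite inE => /andP[].
have ep k : e k != p0 by have := e_in k; rewrite !inE => /andP[].
have eP k : e k \notin P.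
  apply/negP => ekP; have : e k \in T0 :&: P by rewrite inE eT.
  by rewrite T0P inE (negPf (ep k)).
have TV := subsetP (basis_sub cfg T0B).
have /fin_all_exists[H HE] : forall k, exists psi : 'cV[int]_d.+1,
    {in T0, forall i, ev G psi i = (i == e k)%:R}.
  by move=> k; apply: (basis_dual cfg (fun i => (i == e k)%:R) T0B).
pose Phi : 'M[int]_(d.+1, d) := \matrix_(l, k) H k l 0.
pose Gam : 'M[int]_(d, d.+1) := \matrix_(k, l) G (e k) l.
have rowPhi i k : (row i G *m Phi) 0 k = ev G (H k) i.
  by rewrite /ev !mxE; apply: eq_bigr => l _; rewrite !mxE.
have rowphi i : (row i G *m phi) 0 0 = ev G phi i.
  by rewrite -row_mul mxE.
have rowGam k : row k Gam = row (e k) G by apply/rowP=> l; rewrite !mxE.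
have GP : Gam *m Phi = 1%:M.
  apply/row_matrixP => k; rewrite row_mul rowGam; apply/rowP=> l.
  by rewrite rowPhi HE // (inj_eq e_inj) !mxE.
have Gp : Gam *m phi = 0.
  apply/row_matrixP => k; rewrite row_mul rowGam; apply/rowP=> l.
  by rewrite ord1 rowphi phiE ?TV // (negPf (eP k)) !mxE.
have pP : row p0 G *m Phi = 0.
  by apply/rowP=> l; rewrite rowPhi HE // eq_sym (negPf (ep l)) mxE.
have pp : row p0 G *m phi = 1%:M.
  by apply/rowP=> l; rewrite !ord1 rowphi phiE ?(subsetP PV) // p0P mxE.
exists Phi, Gam; split => //.
set M := (X in X = _).
have GM : Gam *m M = Gam.
  by rewrite /M mulmxDr !mulmxA GP Gp mul1mx mul0mx addr0.
have pM : row p0 G *m M = row p0 G.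
  by rewrite /M mulmxDr !mulmxA pP pp mul1mx mul0mx add0r.
have evcolE (A : 'M[int]_d.+1) l i : ev G (col l A) i = (row i G *m A) 0 l.
  by rewrite ev_col -row_mul [RHS]mxE.
suff colM l : col l M = col l 1%:M.
  by apply/matrixP=> k l; have := colM l => /matrixP/(_ k 0);
    rewrite ![col _ _ _ _]mxE.
apply: (functional_eq cfg T0B) => i iT; rewrite !evcolE mulmx1.
have [->|/(e_onto i iT)[k ->]] := eqVneq i p0; first by rewrite pM.
by rewrite -rowGam -row_mul GM.
Qed.

(** The base is the configuration of the d_i with i outside P, in the kernel of
phi, and its bases are the T :\: P. *)
Section Base.
Variables (p0 : 'I_N) (Phi : 'M[int]_(d.+1, d)) (Gam : 'M[int]_(d, d.+1)).
Hypotheses (p0P : p0 \in P) (GP : Gam *m Phi = 1%:M) (Gp : Gam *m phi = 0).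
Hypotheses (pP : row p0 G *m Phi = 0).
Hypothesis split1 : Phi *m Gam + phi *m row p0 G = 1%:M.

Let VP := V :\: P.
Let G' := G *m Phi.
Let B' : {set {set 'I_N}} := [set T :\: P | T : {set 'I_N} in B].

Let phi0 i : i \in VP -> ev G phi i = 0.
Proof. by have [_ phiE _] := fib; rewrite inE => /andP[iP iV];
  rewrite phiE // (negPf iP). Qed.

Let ev_base psi i : ev G' psi i = ev G (Phi *m psi) i.
Proof. by rewrite /ev mulmxA. Qed.

Let ev_lift psi i : i \in VP -> ev G' (Gam *m psi) i = ev G psi i.
Proof.
move=> iV; rewrite ev_base mulmxA.
have -> : Phi *m Gam = 1%:M - phi *m row p0 G by rewrite -split1 addrK.
rewrite mulmxBl mul1mx evB -(mulmxA phi) [X in _ - X](_ : _ = 0) ?subr0 //.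
by rewrite /ev mulmxA [LHS]mxE big_ord1 -/(ev G phi i) phi0 // mul0r.
Qed.

Let G_split : G = G' *m Gam + (G *m phi) *m row p0 G.
Proof. by rewrite /G' -!mulmxA -mulmxDr split1 mulmx1. Qed.

Let base_supp (c : 'rV_N) (T : {set 'I_N}) : T \subset VP -> supported T c ->
  c *m G *m phi = 0.
Proof.
move=> TV sc; apply/matrixP=> i j; rewrite !ord1 (eval_supp _ _ sc) mxE.
by apply: big1 => k kT; rewrite phi0 ?mulr0 // (subsetP TV).
Qed.

Let base_sub (T : {set 'I_N}) : T \in B -> T :\: P \subset VP.
Proof. by move=> TB; apply: setSD; apply: (basis_sub cfg TB). Qed.

Let fibre_dec (T : {set 'I_N}) (c : 'rV_N) : supported (p0 |: T :\: P) c ->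
  c = c 0 p0 *: delta_mx 0 p0 + \row_i (if i \in T :\: P then c 0 i else 0).
Proof.
move=> sc; apply/rowP=> i; rewrite !mxE eqxx /=.
have [->|ip] := eqVneq i p0; first by rewrite !inE p0P /= mulr1 addr0.
rewrite mulr0 add0r; case: ifP => // iT; apply: sc.
by rewrite in_setU1 (negPf ip) iT.
Qed.

(** The vectors of the base are expanded along bases of X through p0; the term
of d_p0 is killed by Phi. *)
Lemma base_config : gale_config VP G' (a *m Phi) B'.
Proof.
split.
- by move=> _ /imsetP[T TB ->]; apply: base_sub.
- move=> _ w /imsetP[T TB ->].
  have [c sc cE] := basis_span cfg (w *m Gam) (bundle_fibre TB p0P).
  have cdec := fibre_dec sc; set c' := (\row_i _) in cdec.
  exists c'.
    by move=> i iT; rewrite mxE (negPf iT).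
  rewrite /G' mulmxA -[LHS]mulmx1 -GP mulmxA cE [in LHS]cdec !mulmxDl.
  by rewrite -!scalemxAl -!rowE pP scaler0 add0r.
- move=> _ z /imsetP[T TB ->].
  have [psi psiE] := basis_dual cfg z TB.
  exists (Gam *m psi) => i iT; rewrite ev_lift ?psiE //.
    by move: iT; rewrite inE => /andP[].
  by apply: (subsetP (base_sub TB)).
- move=> _ /imsetP[T TB ->].
  have [c [sc cpos cE]] := basis_ample cfg (bundle_fibre TB p0P).
  have cdec := fibre_dec sc; set c' := (\row_i _) in cdec.
  exists c'; split=> [i iT|i iT|].
  + by rewrite mxE (negPf iT).
  + by rewrite mxE iT; apply: cpos; rewrite in_setU1 iT orbT.
  + rewrite /G' mulmxA cE [in LHS]cdec !mulmxDl.
    by rewrite -!scalemxAl -!rowE pP scaler0 add0r.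
- move=> z; have [T [psi [TB le eqT]]] := completeness cfg z.
  exists (T :\: P), (Gam *m psi); split=> [|i iV|i iT].
  + by apply/imsetP; exists T.
  + by rewrite ev_lift //; apply: le; move: iV; rewrite inE => /andP[].
  + rewrite ev_lift; last exact: (subsetP (base_sub TB)).
    by apply: eqT; move: iT; rewrite inE => /andP[].
- move=> i; rewrite inE => /andP[iP iV]; have [T TB iT] := basis_avoid cfg iV.
  by exists (T :\: P); [apply/imsetP; exists T | rewrite inE (negPf iT) andbF].
Qed.

(** A facet of the base lifts to X up to multiples of phi, which are chosen such
that the lift has maximum 0 on P.  It vanishes on an element of P where the
maximum is attained, which together with a wall of the base spans a wall of X.
The facet phi is the class of a curve in a fibre. *)
Lemma bundle_lift : unimodular_config G' B' -> unimodular_config G B.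
Proof.
case=> F' [W' [WF walls cones]]; have [PV phiE fibP] := fib.
have /fin_all_exists[q qE] : forall k, exists q,
    q \in P /\ {in P, forall p, (G' *m F') p k <= (G' *m F') q k}.
  move=> k; have p0P' : mem P p0 by [].
  by case: (arg_maxP (fun p => (G' *m F') p k) p0P') => q ? ?; exists q.
pose m : 'rV[int]_d := \row_k (G' *m F') (q k) k.
pose F : 'M[int]_(d.+1, 1 + d) := row_mx phi (Phi *m F' - phi *m m).
pose W : 'M[int]_(1 + d, d.+1) :=
  col_mx (row p0 G + m *m W' *m Gam) (W' *m Gam).
have pp : row p0 G *m phi = 1%:M.
  apply/rowP=> l; rewrite !ord1 -row_mul mxE -/(ev G phi p0)
    phiE ?(subsetP PV) //.
  by rewrite p0P mxE.
have evsupp T c (cT : supported (T :\: P) c) : T \in B ->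
  c *m G = c *m G' *m Gam.
  move=> TB; rewrite [in LHS]G_split mulmxDr !mulmxA.
  by rewrite (base_supp (base_sub TB) cT) mul0mx addr0.
exists F, W; split.
- rewrite -[LHS]/(@mulmx _ (1 + d) d.+1 (1 + d) W F)
    mul_col_row !mulmxDl !mulmxDr !mulmxN !mulmxA pp pP.
  rewrite -!(mulmxA _ Gam) Gp GP !mulmx0 !mul0mx !mulmx1 mul1mx addr0 !subr0
    add0r.
  rewrite -(mulmxA m W') WF mulmx1.
  by rewrite addNr; apply: esym; apply: (@scalar_mx_block _ 1 d).
- move=> k; case: (@split_ordP 1 d k) => j ->.
    rewrite -[col _ F]/(@col _ _ (1 + d) (lshift d j) F) colKl
      (_ : col j phi = phi); last first.
      by apply/matrixP=> x y; rewrite !mxE !ord1.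
    have [T TB p0T] := basis_avoid cfg (subsetP PV _ p0P).
    have [r Tr] := meets_once TB.
    have /setIP[rT rP] : r \in T :&: P by rewrite Tr set11.
    exists (T :\: P), p0, r; split.
    + by rewrite !inE p0P rP /=; split=> //; apply: contraNneq p0T => ->.
    + exact: bundle_fibre.
    + exact: bundle_fibre.
    + by move=> i iT; apply: phi0; apply: (subsetP (base_sub TB)).
    + by rewrite !phiE ?(subsetP PV) // p0P rP.
  rewrite -[col _ F]/(@col _ _ (1 + d) (rshift 1 j) F) colKr;
    set psi := col j _.
  have psiE i : ev G psi i = ev G' (col j F') i - ev G phi i * m 0 j.
    rewrite ev_base -/psi /psi linearB /= !col_mulmx evB; congr (_ - _).
    by rewrite /ev mulmxA [LHS]mxE big_ord1 [(col j m) _ _]mxE.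
  have psiV i : i \in VP -> ev G psi i = ev G' (col j F') i.
    by move=> iV; rewrite psiE phi0 // mul0r subr0.
  have [tau [i [l [[itau ltau il] iB lB tau0 [i1 l1]]]]] := walls j.
  have subV T : T \in B' -> {in T, forall x, x \in VP}.
    by move=> TB x; apply: (subsetP (basis_sub base_config TB)).
  have iV : i \in VP by apply: (subV _ iB); rewrite !inE eqxx.
  have lV : l \in VP by apply: (subV _ lB); rewrite !inE eqxx.
  have [qP qmax] := qE j.
  have notq x : x \in VP -> x != q j.
    by rewrite inE => /andP[xP _]; apply: contraNneq xP => ->.
  have lift x : x |: tau \in B' -> x |: (q j |: tau) \in B.
    by case/imsetP => T TB e; rewrite setUCA e; apply: bundle_fibre.
  exists (q j |: tau), i, l; split.
  + by rewrite !in_setU1 (negPf (notq _ iV)) (negPf (notq _ lV)).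
  + exact: lift.
  + exact: lift.
  + move=> x; rewrite in_setU1 => /orP[/eqP ->|xtau].
      rewrite psiE phiE ?(subsetP PV) // qP mul1r [m _ _]mxE.
      by rewrite ev_col subrr.
    by rewrite psiV ?tau0 //; apply: (subV _ iB); rewrite in_setU1 xtau orbT.
  + by rewrite !psiV.
- move=> k T TB; have [p Tp] := meets_once TB.
  have /setIP[pT pP'] : p \in T :&: P by rewrite Tp set11.
  have TPB' : T :\: P \in B' by apply/imsetP; exists T.
  have /fin_all_exists[c cE] := fun k => cones k _ TPB'.
  pose C : 'M[int]_(d, N) := \matrix_(k, i) c k 0 i.
  have rowC l : row l C = c l by apply/rowP=> i; rewrite !mxE.
  have CG : C *m G = W' *m Gam.
    apply/row_matrixP => l; rewrite !row_mul rowC; have [sc _ ->] := cE l.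
    exact: evsupp sc TB.
  have sub e : supported (T :\: P) e -> supported T e.
    by move=> se i iT; apply: se; rewrite inE (negPf iT) andbF.
  case: (@split_ordP 1 d k) => j ->; last first.
    rewrite -[row _ W]/(@row _ (1 + d) _ (rshift 1 j) W) rowKd row_mul;
      have [sc ge0 ->] := cE j.
    by exists (c j); split=> //; [apply: sub | rewrite (evsupp T)].
  rewrite -[row _ W]/(@row _ (1 + d) _ (lshift d j) W) rowKu
    (_ : row j _ = row p0 G + m *m W' *m Gam); last first.
    by apply/rowP=> x; rewrite ord1 mxE.
  pose n : 'rV[int]_d := m - row p (G' *m F').
  have n_ge0 l : 0 <= n 0 l.
    by rewrite !mxE subr_ge0; have [_ /(_ p pP')] := qE l; rewrite !mxE.
  exists (delta_mx 0 p + n *m C); split.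
  + move=> i iT; rewrite !mxE /= (_ : i == p = false) ?add0r; last first.
      by apply: contraNF iT => /eqP ->.
    apply: big1 => l _; rewrite [C _ _]mxE; have [sc _ _] := cE l.
    by rewrite (sub _ sc) ?mulr0.
  + move=> i; rewrite !mxE /= addr_ge0 ?ler0n //; apply: sumr_ge0 => l _.
    by rewrite [C _ _]mxE mulr_ge0 //; have [_ ->] := cE l.
  + rewrite mulmxDl -rowE -[_ *m C *m G]mulmxA CG mulmxBl.
    have -> : row p G = row p G' *m Gam + row p0 G.
      rewrite {1}G_split linearD /= !row_mul; congr (_ + _).
      rewrite (_ : row p G *m phi = 1%:M) ?mul1mx //.
      apply/rowP=> x; rewrite !ord1 -row_mul mxE -/(ev G phi p)
        phiE ?(subsetP PV) //.
      by rewrite pP' mxE.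
    rewrite row_mul !mulmxA -(mulmxA (row p G')) (mulmx1C WF) mulmx1.
    by rewrite [X in _ = X + _]addrC addrACA subrr addr0.
Qed.

End Base.

Lemma bundle_unimodular :
  (forall V' (G' : 'M[int]_(N, d)) a' B', gale_config V' G' a' B' ->
    unimodular_config G' B') ->
  unimodular_config G B.
Proof.
move=> IH; have [T0 T0B] := basis_ex cfg; have [p0 T0P] := meets_once T0B.
have /setIP[_ p0P] : p0 \in T0 :&: P by rewrite T0P set11.
have [Phi [Gam [GP Gp pP split1]]] := bundle_coordinates p0P.
by apply: (bundle_lift p0P GP Gp pP split1); apply: IH;
  apply: base_config split1.
Qed.

End Bundle.

(** * Bases and the fibre *)

Section FibreGeneral.
Variables (N d : nat) (V : {set 'I_N}) (G : 'M[int]_(N, d)) (a : 'rV[int]_d).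
Variable B : {set {set 'I_N}}.
Hypothesis cfg : gale_config V G a B.
Variables (P : {set 'I_N}) (phi : 'cV[int]_d).
Hypothesis fib : fibration V G B P phi.

(** For a positive functional psi and r \in P, the expansion of a along a
basis that meets P in r alone gives phi(a) psi(d_r) < psi(a).  A basis inside P
would give a as a combination with coefficients of sum phi(a), and psi(a) would
be smaller than itself. *)
Lemma not_in_fibre T : (1 < d)%N -> T \in B -> ~~ (T \subset P).
Proof.
move=> d1 TB; apply/negP => TP; have [PV phiE fibP] := fib.
have [psi psi0] := positive_functional cfg.
have lt r : r \in P -> (a *m phi) 0 0 * ev G psi r < (a *m psi) 0 0.
  move=> rP; have [S SB SP] := fibP r rP.
  have /setIP[rS _] : r \in S :&: P by rewrite SP set11.
  have SV := subsetP (basis_sub cfg SB).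
  have [c [sc cpos ->]] := basis_ample cfg SB; rewrite !(eval_supp _ _ sc).
  have -> : \sum_(i in S) c 0 i * ev G phi i = c 0 r.
    rewrite (bigD1 r) //= phiE ?SV // rP mulr1 big1 ?addr0 // => i /andP[iS ir].
    rewrite phiE ?SV // (_ : i \in P = false) ?mulr0 //.
    apply: contraNF ir => iP; have : i \in S :&: P by rewrite inE iS.
    by rewrite SP inE.
  rewrite [ltRHS](bigD1 r) //= ltrDl.
  have /card_gt0P[i iS] : (0 < #|S :\ r|)%N.
    by have := basis_card cfg SB; rewrite (cardsD1 r) rS; lia.
  move: (iS); rewrite !inE => /andP[ir iS'].
  rewrite (bigD1 i) /= ?iS' //; apply: ltr_wpDr;
    last by rewrite mulr_gt0 ?cpos ?psi0 ?SV.
  by apply: sumr_ge0 => j /andP[/andP[jS _] _];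
    rewrite ltW // mulr_gt0 ?cpos ?psi0 ?SV.
have [c [sc cpos aE]] := basis_ample cfg TB.
have aphi : (a *m phi) 0 0 = \sum_(i in T) c 0 i.
  rewrite aE (eval_supp _ _ sc); apply: eq_bigr => i iT.
  by rewrite phiE ?(subsetP TP) ?mulr1 // (subsetP PV) // (subsetP TP).
have /card_gt0P[t tT] : (0 < #|T|)%N by rewrite (basis_card cfg TB); lia.
have : (a *m phi) 0 0 * (a *m psi) 0 0 < (a *m phi) 0 0 * (a *m psi) 0 0.
  rewrite {2}aE (eval_supp _ _ sc) [X in _ < X * _]aphi mulr_sumr mulr_suml.
  rewrite (bigD1 t) //= [ltRHS](bigD1 t) //=; apply: ltr_leD.
    by rewrite mulrCA ltr_pM2l ?cpos // lt // (subsetP TP).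
  apply: ler_sum => i /andP[iT _].
  by rewrite mulrCA ler_pM2l ?cpos // ltW // lt // (subsetP TP).
by rewrite ltxx.
Qed.

(** Exchanging u into a basis that meets P in p cannot remove p, since every
basis meets P. *)
Lemma section_through p u : p \in P -> u \in V :\: P ->
  exists T, [/\ T \in B, T :&: P = [set p] & u \in T].
Proof.
move=> pP; rewrite inE => /andP[uP uV]; have [PV phiE fibP] := fib.
have [T TB TP] := fibP p pP.
have [uT|uT] := boolP (u \in T); first by exists T.
have [k kT T'B] := exchange cfg TB uV uT.
have P0 : P != finset.set0 by apply/set0Pn; exists p.
have [r rP] := fibration_meets cfg fib P0 T'B.
rewrite !inE => /orP[/eqP ru|/andP[rk rT]]; first by rewrite -ru rP in uP.
have rp : r = p by apply/eqP; rewrite -in_set1 -TP inE rT.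
exists (u |: T :\ k); split; rewrite ?set21 ?setU11 //.
apply/setP=> i; rewrite !inE;
  apply/andP/eqP => [[/orP[/eqP->|/andP[_ iT]] iP]|->].
- by rewrite iP in uP.
- by apply/eqP; rewrite -in_set1 -TP inE iT.
- by rewrite pP -rp rk rT orbT.
Qed.

Lemma unimodular_of_dual (f : 'I_d -> 'cV[int]_d) (w : 'I_d -> 'rV[int]_d) :
  (forall j k, (w j *m f k) 0 0 = (j == k)%:R) ->
  (forall k, wall G B (f k)) ->
  (forall k T, T \in B -> in_cone_of G T (w k)) -> unimodular_config G B.
Proof.
move=> wf walls cones.
exists (\matrix_(i, k) f k i 0), (\matrix_(k, i) w k 0 i); split.
- apply/matrixP=> j k; rewrite !mxE -wf mxE.
  by apply: eq_bigr => i _; rewrite !mxE.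
- move=> k; rewrite (_ : col k _ = f k); first exact: walls.
  by apply/colP=> i; rewrite !mxE.
- move=> k T TB; rewrite (_ : row k _ = w k); first exact: cones.
  by apply/rowP=> i; rewrite !mxE.
Qed.

End FibreGeneral.

(** * Points and directions in the plane *)

Lemma card_set3 (I : finType) (i j k : I) : #|[set i; j; k]| = 3 ->
  [/\ i != j, i != k & j != k].
Proof.
rewrite -setUA !cardsU1 cards1 !inE.
by do 3?[case: eqP => //= _].
Qed.

Lemma set3_of_card (I : finType) (T : {set I}) i j : #|T| = 3 -> i \in T ->
  j \in T ->
  i != j -> exists k, T = [set i; j; k].
Proof.
move=> T3 iT jT ij; have : #|T :\ i :\ j| == 1%N.
  have jTi : j \in T :\ i by rewrite !inE eq_sym ij.
  by have := T3; rewrite (cardsD1 i) iT (cardsD1 j (T :\ i)) jTi !add1n =>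
    -[/eqP].
case/cards1P => k e; exists k; rewrite -setUA -e setD1K ?setD1K //.
by rewrite !inE eq_sym ij.
Qed.

Lemma arg_max_int (I : finType) (Q : {pred I}) (h : I -> int) :
  (exists i, Q i) ->
  exists2 m, Q m & forall i, Q i -> h i <= h m.
Proof. by case=> i0 Q0; case: (arg_maxP h Q0) => m; exists m. Qed.

Lemma int_unit_pos (b m : int) : 0 < m -> b * m = 1 -> m = 1.
Proof.
move=> m0 e; have b0 : 0 < b by rewrite -(pmulr_lgt0 _ m0) e.
have : 0 <= (b - 1) * (m - 1) by rewrite mulr_ge0; lia.
by rewrite mulrBr mulrBl e; lia.
Qed.

(** Coordinates (l, x, y) on Z^3 with l = 1 on the points, which are the members
of P, and l = 0 on the directions; (L, X, Y) are the coordinates of a, and [tri]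
says that three indices form a basis.  The vector from the point r to the trace
of a on the plane l = 1 is a positive multiple of (dx r, dy r), so [tri r u w]
says that it lies in the cone of u and w, and [tri r s u] that a lies in the
half strip with base from r to s and direction u.  All hypotheses about bases
enter through these two kinds of triples. *)
Section Plane.
Variables (I : Type) (pt dir : I -> Prop) (tri : I -> I -> I -> Prop).
Variables (l x y : I -> int) (L X Y : int).
Let dx r := X - L * x r.
Let dy r := Y - L * y r.
Hypothesis L0 : 0 < L.
Hypothesis lP : forall r, pt r -> l r = 1.
Hypothesis lU : forall u, dir u -> l u = 0.
Hypothesis tri_rot : forall i j k, tri i j k -> tri j i k.
Hypothesis tri_swap : forall i j k, tri i j k -> tri i k j.
Hypothesis tri_distinct : forall i j, ~ tri i j j.
Hypothesis pos_PUU : forall r u w, pt r -> dir u -> dir w -> tri r u w ->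
  exists s t : int, [/\ 0 < s, 0 < t, dx r = s * x u + t * x w
                      & dy r = s * y u + t * y w].
Hypothesis span_PUU : forall (m s t : int) r u w, pt r -> dir u -> dir w ->
  0 < m -> 0 <= s -> 0 <= t -> m * dx r = s * x u + t * x w ->
  m * dy r = s * y u + t * y w -> tri r u w.
Hypothesis pos_PPU : forall r s u, pt r -> pt s -> dir u -> tri r s u ->
  exists A C D : int, [/\ 0 < A, 0 < C, 0 < D, A * dx r + C * dx s = D * x u
                      & A * dy r + C * dy s = D * y u].
Hypothesis span_PPU : forall (A C D : int) r s u, pt r -> pt s -> dir u ->
  0 < A -> 0 < C -> 0 <= D -> A * dx r + C * dx s = D * x u ->
  A * dy r + C * dy s = D * y u -> tri r s u.
Hypothesis unit_PUU : forall r u w, pt r -> dir u -> dir w -> tri r u w ->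
  exists b c : int, b * x u + c * y u = 0 /\ b * x w + c * y w = 1.
Hypothesis unit_PPU : forall r s u, pt r -> pt s -> dir u -> tri r s u ->
  exists A b c : int, [/\ A + b * x r + c * y r = 0, A + b * x s + c * y s = 1
    & b * x u + c * y u = 0].
Hypothesis positive_U : exists g1 g2 : int,
  forall u, dir u -> 0 < g1 * x u + g2 * y u.
Hypothesis fibre_tri : forall r, pt r ->
  exists u w, [/\ dir u, dir w & tri r u w].
Hypothesis max_y : forall e : int, (exists2 r, pt r & x r = e) ->
  exists m, [/\ pt m, x m = e & forall r, pt r -> x r = e -> y r <= y m].
Variables (p q v f1 f2 : I).
Hypotheses (pqvB : tri p q v) (p1vB : tri p f1 v) (q2vB : tri q f2 v).
Hypotheses (pP : pt p) (qP : pt q) (vU : dir v) (f1U : dir f1) (f2U : dir f2).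
Hypotheses (xp : x p = 0) (x1 : x f1 = 1) (xv : x v = 0).
Hypotheses (yp : y p = 0) (y1 : y f1 = 0) (yv : y v = 1).

Let not_on_ray (m s : int) r u : pt r -> dir u -> 0 < m -> 0 <= s ->
  m * dx r = s * x u -> m * dy r = s * y u -> False.
Proof.
move=> rP uU m0 s0 ex ey; apply: (@tri_distinct r u).
by apply: (@span_PUU m s 0) => //; rewrite mul0r addr0.
Qed.

Let dp : 0 < dx p /\ 0 < dy p.
Proof.
have [s [t [s0 t0]]] := pos_PUU pP f1U vU p1vB.
by rewrite x1 xv y1 yv => -> ->; split; lia.
Qed.

(** The points p and q lie on different sides of the line through a in direction
v, so f1 and f2 lie on opposite sides of v.  The determinant of v and f2 gives
x f2 = -1, and then p, f1, f2 is a basis whose determinant y f2 must be 1. *)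
Let f2_coords : x f2 = -1 /\ y f2 = 1.
Proof.
have [dxp dyp] := dp.
have dxq : dx q < 0.
  have [A [C [D [A0 C0 D0 + _]]]] := pos_PPU pP qP vU pqvB.
  by rewrite xv; nia.
have [s [t [s0 t0 ex ey]]] := pos_PUU qP f2U vU q2vB; rewrite xv in ex.
have x2_lt0 : x f2 < 0 by nia.
have x2 : x f2 = -1.
  have vf2 : tri q v f2 by apply: tri_swap.
  have [b [c [e1 e2]]] := unit_PUU qP vU f2U vf2.
  rewrite xv yv mulr0 mulr1 add0r in e1; rewrite e1 mul0r addr0 in e2.
  by have := @int_unit_pos (- b) (- x f2); rewrite mulrNN e2; lia.
split=> //; have [g1 [g2 gpos]] := positive_U.
have gf1 := gpos _ f1U; have gf2 := gpos _ f2U; have gv := gpos _ vU.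
rewrite x1 y1 in gf1; rewrite xv yv in gv; rewrite x2 in gf2.
have y2_gt0 : 0 < y f2 by nia.
(* f1 + f2 is a multiple of v, so the cone of f1 and f2 contains v and f1. *)
have p12 : tri p f1 f2.
  apply: (@span_PUU (y f2) (y f2 * dx p + dy p) (dy p)) => //;
    rewrite ?x1 ?y1 ?x2.
  - by nia.
  - by lia.
  - by ring.
  - by ring.
have [b [c [e1 e2]]] := unit_PUU pP f1U f2U p12.
rewrite x1 y1 mulr1 mulr0 addr0 in e1; rewrite e1 mul0r add0r in e2.
exact: int_unit_pos e2.
Qed.

Let dq : dx q < 0 /\ 0 < dx q + dy q.
Proof.
have [s [t [s0 t0]]] := pos_PUU qP f2U vU q2vB.
by have [-> ->] := f2_coords; rewrite xv yv => -> ->; split; lia.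
Qed.

(** Each direction u forms with p or q, and one of f1, v, f2, a triple around a;
which one depends on the sector that contains u, and the determinants leave no
other possibility. *)
Let U_coords u : dir u ->
  [\/ x u = 1 /\ y u = 0, x u = 0 /\ y u = 1 | x u = -1 /\ y u = 1].
Proof.
move=> uU; have [g1 [g2 gpos]] := positive_U; have [x2 y2] := f2_coords.
have gf1 := gpos _ f1U; have gf2 := gpos _ f2U; have gv := gpos _ vU.
rewrite x1 y1 in gf1; rewrite xv yv in gv; rewrite x2 y2 in gf2.
have gu := gpos _ uU; have [dxp dyp] := dp; have [dxq dyq] := dq.
have [xu|xu] := ltP (x u) 0.
  have yu0 : 0 < y u by nia.
  have p1u : tri p f1 u.
    apply: (@span_PUU (y u) (y u * dx p - x u * dy p) (dy p)) => //.
    - by nia.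
    - by lia.
    - by rewrite x1; ring.
    - by rewrite y1; ring.
  have yu : y u = 1.
    have [b [c [e1 e2]]] := unit_PUU pP f1U uU p1u.
    rewrite x1 y1 mulr1 mulr0 addr0 in e1; rewrite e1 mul0r add0r in e2.
    exact: int_unit_pos e2.
  have [xu1|xu2] := eqVneq (x u) (-1); first by constructor 3.
  have qvu : tri q v u.
    apply: (@span_PUU (- x u) (- x u * dy q + dx q) (- dx q)) => //.
    - by lia.
    - by nia.
    - by lia.
    - by rewrite xv; ring.
    - by rewrite yv yu; ring.
  have [b [c [e1 e2]]] := unit_PUU qP vU uU qvu.
  rewrite xv yv mulr0 mulr1 add0r in e1; rewrite e1 mul0r addr0 in e2.
  by have := @int_unit_pos (- b) (- x u); rewrite mulrNN e2; lia.
have s0 : 0 < x u + y u by nia.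
have q2u : tri q f2 u.
  apply: (@span_PUU (x u + y u) (x u * dy q - y u * dx q) (dx q + dy q)) => //.
  - by nia.
  - by lia.
  - by rewrite x2; ring.
  - by rewrite y2; ring.
have s1 : x u + y u = 1.
  have [b [c [e1 e2]]] := unit_PUU qP f2U uU q2u.
  rewrite x2 y2 in e1; apply: (@int_unit_pos b) => //.
  have bc : b = c by lia.
  by rewrite mulrDr {2}bc.
have [xu0|xu0] := eqVneq (x u) 0; first by constructor 2; split=> //; lia.
have [yu|yu] := ltP 0 (y u); first by lia.
have pvu : tri p v u.
  apply: (@span_PUU (x u) (x u * dy p - y u * dx p) (dx p)) => //.
  - by lia.
  - by nia.
  - by lia.
  - by rewrite xv; ring.
  - by rewrite yv; ring.
have [b [c [e1 e2]]] := unit_PUU pP vU uU pvu.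
rewrite xv yv mulr0 mulr1 add0r in e1; rewrite e1 mul0r addr0 in e2.
have xu1 : x u = 1 by apply: int_unit_pos e2; lia.
by constructor 1; split=> //; lia.
Qed.

(** The vector from r to a lies in the cone of two directions, hence in the
sector from f1 to f2.  It is not a multiple of f1, v or f2, because a would then
be a combination of only two vectors. *)
Let P_sector r : pt r -> [/\ 0 < dy r, 0 < dx r + dy r & dx r != 0].
Proof.
move=> rP; have [u [w [uU wU ruw]]] := fibre_tri rP.
have [s [t [s0 t0 ex ey]]] := pos_PUU rP uU wU ruw.
have dyr : 0 <= dy r.
  by rewrite ey; case: (U_coords uU) => -[_ ->]; case: (U_coords wU) => -[_ ->];
    lia.
have dsr : 0 <= dx r + dy r.
  by rewrite ex ey; case: (U_coords uU) => -[-> ->];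
    case: (U_coords wU) => -[-> ->]; lia.
have [x2 y2] := f2_coords.
have dxr : dx r != 0.
  apply/negP => /eqP dx0; apply: (@not_on_ray 1 (dy r) r v) => //.
    by rewrite xv dx0 !mulr0.
  by rewrite yv mul1r mulr1.
split=> //; rewrite lt_neqAle eq_sym ?dyr ?dsr andbT; apply/negP => /eqP d0.
- apply: (@not_on_ray 1 (dx r) r f1) => //; first by lia.
    by rewrite x1 mul1r mulr1.
  by rewrite y1 d0 !mulr0.
- apply: (@not_on_ray 1 (dy r) r f2) => //; first by rewrite x2; lia.
  by rewrite y2; lia.
Qed.

(** Points on different sides of the line through a in direction v form a basis
with v, and its determinant is the difference of their x. *)
Let step r s : pt r -> pt s -> 0 < dx r -> dx s < 0 ->
  tri r s v /\ x s = x r + 1.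
Proof.
move=> rP sP dxr dxs; have [dyr _ _] := P_sector rP;
  have [dys _ _] := P_sector sP.
have rsB : tri r s v.
  apply: (@span_PPU (- dx s) (dx r) (- dx s * dy r + dx r * dy s)) => //.
  - by lia.
  - by nia.
  - by rewrite xv; ring.
  - by rewrite yv; ring.
split=> //; have [A [b [c [e1 e2 e3]]]] := unit_PPU rP sP vU rsB.
rewrite xv yv in e3.
have lt : x r < x s by move: dxr dxs; rewrite /dx; nia.
have : b * (x s - x r) = 1 by nia.
by move/int_unit_pos => <-; lia.
Qed.

Let P_coords r : pt r -> x r = 0 /\ 0 < dx r \/ x r = 1 /\ dx r < 0.
Proof.
move=> rP; have [dxp _] := dp; have [dxq _] := dq.
have [_ xq] := step pP qP dxp dxq; rewrite xp add0r in xq.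
have [_ _] := P_sector rP; rewrite neq_lt => /orP[dxr|dxr].
  by right; have [_ ->] := step pP rP dxp dxr; rewrite xp.
by left; have [_] := step rP qP dxr dxq; rewrite xq; lia.
Qed.

Let dx_of0 r : pt r -> x r = 0 -> 0 < dx r.
Proof. by move=> /P_coords; lia. Qed.
Let dx_of1 r : pt r -> x r = 1 -> dx r < 0.
Proof. by move=> /P_coords; lia. Qed.

Let B01 r : pt r -> x r = 0 -> tri r f1 v.
Proof.
move=> rP r0; have dxr := dx_of0 rP r0; have [dyr _ _] := P_sector rP.
apply: (@span_PUU 1 (dx r) (dy r)) => //; rewrite ?(ltW dxr) ?(ltW dyr) //.
  by rewrite x1 xv; ring.
by rewrite y1 yv; ring.
Qed.

Let B02 r : pt r -> x r = 0 -> tri r f1 f2.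
Proof.
move=> rP r0; have dxr := dx_of0 rP r0; have [dyr dsr _] := P_sector rP.
have [x2 y2] := f2_coords.
apply: (@span_PUU 1 (dx r + dy r) (dy r)) => //;
  rewrite ?(ltW dsr) ?(ltW dyr) //.
  by rewrite x1 x2; ring.
by rewrite y1 y2; ring.
Qed.

Let B12 r : pt r -> x r = 1 -> tri r f2 v.
Proof.
move=> rP r1; have dxr := dx_of1 rP r1; have [dyr dsr _] := P_sector rP.
have [x2 y2] := f2_coords.
apply: (@span_PUU 1 (- dx r) (dx r + dy r)) => //; rewrite ?(ltW dsr) //.
- by lia.
- by rewrite x2 xv; ring.
- by rewrite y2 yv; ring.
Qed.

Let B11 r : pt r -> x r = 1 -> tri r f2 f1.
Proof.
move=> rP r1; have dxr := dx_of1 rP r1; have [dyr dsr _] := P_sector rP.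
have [x2 y2] := f2_coords.
apply: (@span_PUU 1 (dy r) (dx r + dy r)) => //;
  rewrite ?(ltW dsr) ?(ltW dyr) //.
- by rewrite x2 x1; ring.
- by rewrite y2 y1; ring.
Qed.

Let cone0 r u w (ex ey : int) : pt r -> x r = 0 -> dir u -> dir w ->
  tri r u w ->
  0 <= ex -> 0 <= ey -> exists C D : int,
  [/\ 0 <= C, 0 <= D, C * x u + D * x w = ex & C * y u + D * y w = ey].
Proof.
move=> rP r0 uU wU ruw ex0 ey0; have dxr := dx_of0 rP r0.
have [dyr dsr _] := P_sector rP;
  have [s [t [s0 t0 exr eyr]]] := pos_PUU rP uU wU ruw.
rewrite exr eyr in dxr dyr.
case: (U_coords uU) dxr dyr => -[-> ->];
  case: (U_coords wU) => -[-> ->] dxr dyr; try lia.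
- by exists ex, ey; split=> //; lia.
- by exists (ex + ey), ey; split=> //; lia.
- by exists ey, ex; split=> //; lia.
- by exists ey, (ex + ey); split=> //; lia.
Qed.

Let cone1 r u w (ex ey : int) : pt r -> x r = 1 -> dir u -> dir w ->
  tri r u w ->
  ex <= 0 -> 0 <= ex + ey -> exists C D : int,
  [/\ 0 <= C, 0 <= D, C * x u + D * x w = ex & C * y u + D * y w = ey].
Proof.
move=> rP r1 uU wU ruw ex0 ey0; have dxr := dx_of1 rP r1.
have [dyr dsr _] := P_sector rP;
  have [s [t [s0 t0 exr eyr]]] := pos_PUU rP uU wU ruw.
rewrite exr eyr in dxr dsr.
case: (U_coords uU) dxr dsr => -[-> ->];
  case: (U_coords wU) => -[-> ->] dxr dsr; try lia.
- by exists (ex + ey), ey; split=> //; lia.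
- by exists (ex + ey), (- ex); split=> //; lia.
- by exists ey, (ex + ey); split=> //; lia.
- by exists (- ex), (ex + ey); split=> //; lia.
Qed.

(** A positive combination of the vectors from r and s to a is in the open upper
sector between f1 and f2, so u = v. *)
Let tri_PPU r s u : pt r -> pt s -> dir u -> tri r s u ->
  [/\ x u = 0, y u = 1 & x r = 0 /\ x s = 1 \/ x r = 1 /\ x s = 0].
Proof.
move=> rP sP uU rsu; have [A [C [D [A0 C0 D0 ex ey]]]] := pos_PPU rP sP uU rsu.
have [dyr dsr _] := P_sector rP; have [dys dss _] := P_sector sP.
have Ay : 0 < A * dy r + C * dy s by rewrite addr_gt0 ?mulr_gt0.
have As : 0 < A * (dx r + dy r) + C * (dx s + dy s)
  by rewrite addr_gt0 ?mulr_gt0.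
have xu0 : x u = 0 /\ y u = 1.
  by case: (U_coords uU) ex ey => -[-> ->] ex ey; lia.
case: xu0 ex => xu yu; rewrite xu mulr0 => ex; split=> //.
by case: (P_coords rP) => -[xr dr]; case: (P_coords sP) => -[xs ds];
  [nia|left|right|nia].
Qed.

Definition scalar_wall (e f g : int) := exists c d i j,
  [/\ tri c d i, tri c d j, i <> j,
      e * l c + f * x c + g * y c = 0 /\ e * l d + f * x d + g * y d = 0
    & e * l i + f * x i + g * y i = 1 /\ e * l j + f * x j + g * y j = 1].

Definition scalar_cone i j k (wl wx wy : int) := exists A C D : int,
  [/\ [/\ 0 <= A, 0 <= C & 0 <= D], A * l i + C * l j + D * l k = wl,
      A * x i + C * x j + D * x k = wx & A * y i + C * y j + D * y k = wy].

(** Let al and be be the heights of the highest points on the lines x = 0 and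
x = 1.  The nef cone is cut out by x >= 0, x <= l, and the higher of the line
with direction f1 through (0, al) and the line with direction f2 through
(1, be): at x = 0 the second has height be + 1, at x = 1 height be, so the first
one dominates on the whole strip if be < al, and the second one otherwise.  The
remaining two vertices have the heights M at x = 1 and M' at x = 0. *)
Lemma plane_nef : exists M M' : int,
  [/\ scalar_wall 0 1 0, scalar_wall 1 (-1) 0, scalar_wall (- M') (M' - M) 1,
      forall r u w, pt r -> dir u -> dir w -> tri r u w ->
        [/\ scalar_cone r u w 1 1 M, scalar_cone r u w 1 0 M' & scalar_cone r u
          w 0 0 1]
    & forall r s u, pt r -> pt s -> dir u -> tri r s u ->
        [/\ scalar_cone r s u 1 1 M, scalar_cone r s u 1 0 M' & scalar_cone r s
          u 0 0 1]].
Proof.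
have [x2 y2] := f2_coords; have [dxp _] := dp; have [dxq _] := dq.
have [_ xq] := step pP qP dxp dxq; rewrite xp add0r in xq.
have [al [alP alx almax]] := max_y (ex_intro2 _ _ p pP xp).
have [be [beP bex bemax]] := max_y (ex_intro2 _ _ q qP xq).
have [M [M' [bound F3]]] :
  exists M M', (forall r, pt r ->
    [/\ y r <= M, y r <= M' & x r = 1 -> y r + 1 <= M'])
  /\ scalar_wall (- M') (M' - M) 1.
  (* The third facet is y - al l in the first case, x + y - (be + 1) l in the
  second one. *)
  have [ltba|leab] := ltP (y be) (y al).
    exists (y al), (y al); split.
      move=> r rP; case: (P_coords rP) => -[xr _].
        by have := almax r rP xr; split; lia.
      by have := bemax r rP xr; split; lia.
    exists al, f1, v, f2; split.
    - exact: B01.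
    - exact: B02.
    - by move=> e; move: x2; rewrite -e xv; lia.
    - by rewrite (lP alP) (lU f1U) x1 y1 alx; split; lia.
    - by rewrite (lU vU) (lU f2U) xv yv x2 y2; split; lia.
  exists (y be), (y be + 1); split.
    move=> r rP; case: (P_coords rP) => -[xr _].
      by have := almax r rP xr; split; lia.
    by have := bemax r rP xr; split; lia.
  exists be, f2, v, f1; split.
  - exact: B12.
  - exact: B11.
  - by move=> e; move: x1; rewrite -e xv; lia.
  - by rewrite (lP beP) (lU f2U) x2 y2 bex; split; lia.
  - by rewrite (lU vU) (lU f1U) xv yv x1 y1; split; lia.
exists M, M'; split=> //.
- exists p, v, f1, q; split; [exact: tri_swap | exact: tri_swap | | |].
  + by move=> e; have := lP qP; rewrite -e (lU f1U).
  + by rewrite (lP pP) (lU vU) xp xv; split; lia.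
  + by rewrite (lP qP) (lU f1U) x1 xq; split; lia.
- exists q, v, p, f2; split;
    [by apply/tri_swap/tri_rot | exact: tri_swap | | |].
  + by move=> e; have := lP pP; rewrite e (lU f2U).
  + by rewrite (lP qP) (lU vU) xq xv; split; lia.
  + by rewrite (lP pP) (lU f2U) xp x2; split; lia.
- move=> r u w rP uU wU ruw; have [b1 b2 b3] := bound r rP.
  rewrite /scalar_cone (lP rP) (lU uU) (lU wU).
  have [[xr _]|[xr _]] := P_coords rP; rewrite xr.
    have [||C1 [D1 [? ? e1 e1']]] :=
      cone0 (ex := 1) (ey := M - y r) rP xr uU wU ruw; [lia..|].
    have [||C2 [D2 [? ? e2 e2']]] :=
      cone0 (ex := 0) (ey := M' - y r) rP xr uU wU ruw; [lia..|].
    have [||C3 [D3 [? ? e3 e3']]] := cone0 (ex := 0) (ey := 1) rP xr uU wU ruw;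
      [lia..|].
    by split; [exists 1, C1, D1 | exists 1, C2, D2 | exists 0, C3, D3];
      split=> //; lia.
  have {}b3 := b3 xr.
  have [||C1 [D1 [? ? e1 e1']]] :=
    cone1 (ex := 0) (ey := M - y r) rP xr uU wU ruw; [lia..|].
  have [||C2 [D2 [? ? e2 e2']]] :=
    cone1 (ex := -1) (ey := M' - y r) rP xr uU wU ruw; [lia..|].
  have [||C3 [D3 [? ? e3 e3']]] := cone1 (ex := 0) (ey := 1) rP xr uU wU ruw;
    [lia..|].
  by split; [exists 1, C1, D1 | exists 1, C2, D2 | exists 0, C3, D3];
    split=> //; lia.
- move=> r s u rP sP uU rsu; have [xu yu rs] := tri_PPU rP sP uU rsu.
  have [b1 b2 b3] := bound r rP; have [c1 c2 c3] := bound s sP.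
  rewrite /scalar_cone (lP rP) (lP sP) (lU uU) xu yu.
  by case: rs => -[xr xs]; rewrite xr xs; (split;
    [ exists (x r), (x s), (M - x r * y r - x s * y s)
    | exists (x s), (x r), (M' - x s * y r - x r * y s) | exists 0, 0, 1]);
    rewrite ?xr ?xs; (split; [split=> //; try lia | try lia..]).
Qed.

End Plane.

(** * Rank three *)

Section Rank3.
Variables (N : nat) (V : {set 'I_N}) (G : 'M[int]_(N, 3)) (a : 'rV[int]_3).
Variable B : {set {set 'I_N}}.
Hypothesis cfg : gale_config V G a B.
Variables (P : {set 'I_N}) (phi : 'cV[int]_3).
Hypothesis fib : fibration V G B P phi.
Variables (p q v f1 f2 : 'I_N) (X Y : 'cV[int]_3).
Hypotheses (pq : [set p; q; v] \in B) (p1 : [set p; f1; v] \in B).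
Hypothesis q2 : [set q; f2; v] \in B.
Hypotheses (pP : p \in P) (qP : q \in P) (vP : v \notin P).
Hypotheses (f1P : f1 \notin P) (f2P : f2 \notin P).
Hypothesis XE : [/\ ev G X p = 0, ev G X f1 = 1 & ev G X v = 0].
Hypothesis YE : [/\ ev G Y p = 0, ev G Y f1 = 0 & ev G Y v = 1].

Let l i := ev G phi i.
Let x i := ev G X i.
Let y i := ev G Y i.
Let L := (a *m phi) 0 0.
Let AX := (a *m X) 0 0.
Let AY := (a *m Y) 0 0.

Let inV T i : T \in B -> i \in T -> i \in V.
Proof. by move=> TB; apply: (subsetP (basis_sub cfg TB)). Qed.

Let lP i : i \in P -> l i = 1.
Proof. by have [PV phiE _] := fib; move=> iP;
  rewrite /l phiE ?iP ?(subsetP PV). Qed.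

Let lU i : i \in V -> i \notin P -> l i = 0.
Proof. by have [PV phiE _] := fib; move=> iV iP;
  rewrite /l phiE // (negPf iP). Qed.

Let f1V : f1 \in V. Proof. by apply: inV p1 _; rewrite !inE eqxx orbT. Qed.
Let f2V : f2 \in V. Proof. by apply: inV q2 _; rewrite !inE eqxx orbT. Qed.
Let vV : v \in V. Proof. by apply: inV q2 _; rewrite !inE eqxx !orbT. Qed.
Let PV i : i \in P -> i \in V.
Proof. by have [PV _ _] := fib; apply: (subsetP PV). Qed.

Let distinct i j k : [set i; j; k] \in B -> [/\ i != j, i != k & j != k].
Proof. by move=> /(basis_card cfg)/card_set3. Qed.

Let big3 (E : 'I_N -> int) i j k : i != j -> i != k -> j != k ->
  \sum_(t in [set i; j; k]) E t = E i + E j + E k.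
Proof.
move=> ij ik jk; rewrite -setUA big_setU1 ?inE ?negb_or ?ij //=.
by rewrite big_setU1 ?inE //= big_set1 addrA.
Qed.

Let coords psi i : ev G psi i =
  ev G psi p * l i + ev G psi f1 * x i + ev G psi v * y i.
Proof.
have {1}-> : psi = ev G psi p *: phi + ev G psi f1 *: X + ev G psi v *: Y.
  apply: (functional_eq cfg p1) => t; rewrite !evD !evZ -/(l t).
  have [[xp x1 xv] [yp y1 yv]] := (XE, YE).
  rewrite !inE => /orP[/orP[]|] /eqP ->.
  - by rewrite xp yp lP // mulr1 !mulr0 !addr0.
  - by rewrite x1 y1 lU // mulr1 !mulr0 add0r addr0.
  - by rewrite xv yv lU // mulr1 !mulr0 !add0r.
by rewrite !evD !evZ.
Qed.

(** The coordinates of a vector determine it since p, f1, v is a basis. *)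
Let row_eq (w w' : 'rV[int]_3) : (w *m phi) 0 0 = (w' *m phi) 0 0 ->
  (w *m X) 0 0 = (w' *m X) 0 0 -> (w *m Y) 0 0 = (w' *m Y) 0 0 -> w = w'.
Proof.
move=> el ex ey; apply/eqP; rewrite -subr_eq0.
have [c sc cE] := basis_span cfg (w - w') p1; rewrite cE.
suff -> : c = 0 by rewrite mul0mx.
have [[xp x1 xv] [yp y1 yv]] := (XE, YE).
have [d1 d2 d3] := distinct p1.
have ev0 psi : (w *m psi) 0 0 = (w' *m psi) 0 0 ->
    c 0 p * ev G psi p + c 0 f1 * ev G psi f1 + c 0 v * ev G psi v = 0.
  move=> e; rewrite -(big3 (fun t => c 0 t * ev G psi t)) // -(eval_supp _ _ sc)
    -cE.
  by rewrite mulmxBl [LHS]mxE [X in _ + X]mxE e subrr.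
have := ev0 _ el; have := ev0 _ ex; have := ev0 _ ey.
rewrite xp x1 xv yp y1 yv -!/(l _) (lP pP) !lU // !mulr0 !mulr1 !add0r !addr0 =>
  c1 c2 c3.
apply/rowP=> t; rewrite [RHS]mxE.
have [|/sc //] := boolP (t \in [set p; f1; v]).
by rewrite !inE => /orP[/orP[]|] /eqP ->.
Qed.

Let comb3 (A C D : int) i j k : {psi : 'rV[int]_N |
  [/\ supported [set i; j; k] psi, 0 <= A -> 0 <= C -> 0 <= D ->
    forall t, 0 <= psi 0 t
   & forall h : 'cV[int]_3, (psi *m G *m h) 0 0 =
     A * ev G h i + C * ev G h j + D * ev G h k]}.
Proof.
exists (A *: delta_mx 0 i + C *: delta_mx 0 j + D *: delta_mx 0 k); split.
- move=> t; rewrite !inE !negb_or -andbA => /and3P[ti tj tk].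
  by rewrite !mxE (negPf ti) (negPf tj) (negPf tk) !mulr0 !addr0.
- move=> A0 C0 D0 t; rewrite !mxE.
  by rewrite !addr_ge0 // mulr_ge0 // ler0n.
- move=> h; rewrite !mulmxDl -!scalemxAl -!rowE [LHS]mxE [X in X + _]mxE.
  rewrite ![(_ *: _ : 'M__) _ _]mxE -!row_mul ![(row _ _) _ _]mxE.
  by [].
Qed.

Let span3 (A C D m : int) i j k : i \in V -> j \in V -> k \in V ->
  0 < m -> 0 <= A -> 0 <= C -> 0 <= D ->
  A * l i + C * l j + D * l k = m * L ->
  A * x i + C * x j + D * x k = m * AX ->
  A * y i + C * y j + D * y k = m * AY -> [set i; j; k] \in B.
Proof.
move=> iV jV kV m0 A0 C0 D0 el ex ey; have [c [sc cge cE]] := comb3 A C D i j k.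
have [] := basis_in_support cfg m0 _ (cge A0 C0 D0).
- move=> t tV; apply: sc; apply: contra tV.
  by rewrite !inE => /orP[/orP[]|] /eqP ->.
- by apply: row_eq; rewrite cE -scalemxAl [RHS]mxE.
move=> T TB cpos; suff <- : T = [set i; j; k] by [].
apply/eqP; rewrite eqEcard (basis_card cfg TB) -setUA !cardsU1 cards1.
apply/andP; split; last by case: (_ \notin _); case: (_ \notin _).
apply/subsetP=> t tT; rewrite setUA; apply: contraT => /sc ct.
by have := cpos t tT; rewrite ct.
Qed.

Let pos3 i j k : [set i; j; k] \in B -> exists A C D : int,
  [/\ [/\ 0 < A, 0 < C & 0 < D], A * l i + C * l j + D * l k = L,
      A * x i + C * x j + D * x k = AX & A * y i + C * y j + D * y k = AY].
Proof.
move=> TB; have [c [sc cpos cE]] := basis_ample cfg TB;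
  have [d1 d2 d3] := distinct TB.
exists (c 0 i), (c 0 j), (c 0 k).
have e h : c 0 i * ev G h i + c 0 j * ev G h j + c 0 k * ev G h k =
  (a *m h) 0 0.
  by rewrite cE (eval_supp _ _ sc) big3.
by split; [split; apply: cpos; rewrite !inE eqxx ?orbT | exact: e..].
Qed.

Let unit3 i j k : [set i; j; k] \in B -> exists A b c : int,
  [/\ A * l i + b * x i + c * y i = 0, A * l j + b * x j + c * y j = 0
    & A * l k + b * x k + c * y k = 1].
Proof.
move=> TB; have [psi psiE] := basis_dual cfg (fun t => (t == k)%:R) TB.
have [d1 d2 d3] := distinct TB.
exists (ev G psi p), (ev G psi f1), (ev G psi v).
by rewrite -!coords !psiE ?inE ?eqxx ?orbT // (negPf d2) (negPf d3).
Qed.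

Let U := V :\: P.
Let UV i : i \in U -> i \in V. Proof. by rewrite inE => /andP[]. Qed.
Let lU0 i : i \in U -> l i = 0.
Proof. by rewrite inE => /andP[iP iV]; apply: lU. Qed.
Let vU : v \in U. Proof. by rewrite inE vP vV. Qed.
Let f1U : f1 \in U. Proof. by rewrite inE f1P f1V. Qed.
Let f2U : f2 \in U. Proof. by rewrite inE f2P f2V. Qed.

Let L0 : 0 < L.
Proof.
have /pos3[A [C [D [[A0 C0 D0]]]]] := p1.
by rewrite (lP pP) (lU0 f1U) (lU0 vU) => <- _ _; rewrite mulr1 !mulr0 !addr0.
Qed.

Let dx r := AX - L * x r.
Let dy r := AY - L * y r.

Let pos_PUU r u w : r \in P -> u \in U -> w \in U -> [set r; u; w] \in B ->
  exists s t : int, [/\ 0 < s, 0 < t, dx r = s * x u + t * x w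
                      & dy r = s * y u + t * y w].
Proof.
move=> rP uU wU /pos3[A [C [D [[A0 C0 D0]]]]];
  rewrite (lP rP) (lU0 uU) (lU0 wU).
rewrite mulr1 !mulr0 !addr0 => AL ex ey.
by exists C, D; rewrite /dx /dy -ex -ey -AL; split=> //; ring.
Qed.

Let span_PUU (m s t : int) r u w : r \in P -> u \in U -> w \in U ->
  0 < m -> 0 <= s -> 0 <= t -> m * dx r = s * x u + t * x w ->
  m * dy r = s * y u + t * y w -> [set r; u; w] \in B.
Proof.
move=> rP uU wU m0 s0 t0 ex ey.
apply: (span3 (A := m * L) (PV rP) (UV uU) (UV wU) m0 _ s0 t0).
- by rewrite mulr_ge0 // ltW // L0.
- by rewrite (lP rP) (lU0 uU) (lU0 wU); ring.
- by rewrite -addrA -ex /dx; ring.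
- by rewrite -addrA -ey /dy; ring.
Qed.

Let pos_PPU r s u : r \in P -> s \in P -> u \in U -> [set r; s; u] \in B ->
  exists A C D : int, [/\ 0 < A, 0 < C, 0 < D, A * dx r + C * dx s = D * x u
                      & A * dy r + C * dy s = D * y u].
Proof.
move=> rP sP uU /pos3[A [C [D [[A0 C0 D0]]]]].
rewrite (lP rP) (lP sP) (lU0 uU) !mulr1 mulr0 addr0 => AL ex ey.
exists A, C, (L * D); rewrite mulr_gt0 ?L0 //; split=> //.
  by rewrite /dx -ex -AL; ring.
by rewrite /dy -ey -AL; ring.
Qed.

Let span_PPU (A C D : int) r s u : r \in P -> s \in P -> u \in U ->
  0 < A -> 0 < C -> 0 <= D -> A * dx r + C * dx s = D * x u ->
  A * dy r + C * dy s = D * y u -> [set r; s; u] \in B.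
Proof.
move=> rP sP uU A0 C0 D0 ex ey.
apply: (span3 (A := L * A) (C := L * C) (PV rP) (PV sP) (UV uU)
  (addr_gt0 A0 C0) _ _ D0).
- by rewrite mulr_ge0 // ltW // L0.
- by rewrite mulr_ge0 // ltW // L0.
- by rewrite (lP rP) (lP sP) (lU0 uU); ring.
- by rewrite -ex /dx; ring.
- by rewrite -ey /dy; ring.
Qed.

Let unit_PUU r u w : r \in P -> u \in U -> w \in U -> [set r; u; w] \in B ->
  exists b c : int, b * x u + c * y u = 0 /\ b * x w + c * y w = 1.
Proof.
move=> rP uU wU /unit3[A [b [c]]]; rewrite (lU0 uU) (lU0 wU) mulr0 !add0r.
by case=> _ e1 e2; exists b, c.
Qed.

Let unit_PPU r s u : r \in P -> s \in P -> u \in U -> [set r; s; u] \in B ->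
  exists A b c : int, [/\ A + b * x r + c * y r = 0, A + b * x s + c * y s = 1
    & b * x u + c * y u = 0].
Proof.
move=> rP sP uU; rewrite setUC setUA => /unit3[A [b [c]]].
rewrite (lU0 uU) (lP rP) (lP sP) mulr0 mulr1 add0r.
by case=> e1 e2 e3; exists A, b, c; split.
Qed.

Let positive_U : exists g1 g2 : int, forall u, u \in U -> 0 < g1 * x u + g2 * y
  u.
Proof.
have [psi psi0] := positive_functional cfg.
exists (ev G psi f1), (ev G psi v) => u uU.
by have := psi0 u (UV uU); rewrite coords (lU0 uU) mulr0 add0r.
Qed.

Let section_U r : r \in P ->
  exists u w, [/\ u \in U, w \in U & [set r; u; w] \in B].
Proof.
move=> rP; have [_ _ fibP] := fib; have [T TB TP] := fibP _ rP.
have /setIP[rT _] : r \in T :&: P by rewrite TP set11.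
have TU i : i \in T -> r != i -> i \in U.
  move=> iT ri; rewrite inE (inV TB iT) andbT; apply: contraNN ri => iP.
  by rewrite eq_sym -in_set1 -TP inE iT.
have [u uT ru] : exists2 u, u \in T & r != u.
  have /card_gt0P[u] : (0 < #|T :\ r|)%N.
    by have := basis_card cfg TB; rewrite (cardsD1 r) rT add1n => -[->].
  by rewrite !inE eq_sym => /andP[? ?]; exists u.
have [w TE] := set3_of_card (basis_card cfg TB) rT uT ru.
have TB' := TB; rewrite TE in TB'; have [_ rw _] := distinct TB'.
by exists u, w; split; rewrite ?TU // TE !inE eqxx orbT.
Qed.

Let max_y (e : int) : (exists2 r, r \in P & x r = e) ->
  exists m, [/\ m \in P, x m = e & forall r, r \in P -> x r = e -> y r <= y m].
Proof.
case=> r rP re; pose Q := [pred r | (r \in P) && (x r == e)].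
have [|m /andP[mP /eqP me] mmax] := @arg_max_int _ Q y.
  by exists r; rewrite /= rP re eqxx.
by exists m; split=> // s sP se; apply: mmax; rewrite /= sP se eqxx.
Qed.

Let fvec e f g := e *: phi + f *: X + g *: Y.
Let wvec b c d := b *: row p G + c *: row f1 G + d *: row v G.

Let fvecE e f g i : ev G (fvec e f g) i = e * l i + f * x i + g * y i.
Proof. by rewrite !evD !evZ. Qed.

Let wvecE b c d psi :
  (wvec b c d *m psi) 0 0 = b * ev G psi p + c * ev G psi f1 + d * ev G psi v.
Proof.
rewrite /wvec !mulmxDl -!scalemxAl [LHS]mxE [X in X + _]mxE.
by rewrite ![(_ *: _ : 'M__) _ _]mxE -!row_mul ![(row _ _) _ _]mxE.
Qed.

Let pairing b c d e f g :
  (wvec b c d *m fvec e f g) 0 0 = b * e + c * f + d * g.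
Proof.
have [[_ x1 xv] [_ y1 yv]] := (XE, YE); have [xp _ _] := XE;
  have [yp _ _] := YE.
rewrite wvecE !fvecE /x /y xp x1 xv yp y1 yv (lP pP) (lU0 f1U) (lU0 vU).
by rewrite !mulr0 !mulr1 !addr0 !add0r.
Qed.

Let tri i j k : Prop := [set i; j; k] \in B.

Let wall_of_scalar e f g : scalar_wall tri l x y e f g -> wall G B (fvec e f g).
Proof.
case=> c [d [i [j [cdi cdj ij [c0 d0] [i1 j1]]]]].
have [_ ci di] := distinct cdi; have [_ cj dj] := distinct cdj.
exists [set c; d], i, j; rewrite ![_ |: [set c; d]]setUC !fvecE; split=> //.
- by split; [rewrite !inE negb_or ![i == _]eq_sym ci | rewrite !inE
    negb_or ![j == _]eq_sym cj
    | apply/eqP].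
- by move=> k; rewrite fvecE !inE => /orP[] /eqP ->.
Qed.

Let cone_of_scalar i j k b c d : scalar_cone l x y i j k b c d ->
  in_cone_of G [set i; j; k] (wvec b c d).
Proof.
case=> A [C [D [[A0 C0 D0] el ex ey]]];
  have [e [se ege eE]] := comb3 A C D i j k.
have [[_ x1 xv] [_ y1 yv]] := (XE, YE); have [xp _ _] := XE;
  have [yp _ _] := YE.
exists e; split=> //; first exact: ege.
apply: row_eq; rewrite eE wvecE.
- by rewrite -!/(l _) el (lP pP) (lU0 f1U) (lU0 vU) mulr1 !mulr0 !addr0.
- by rewrite xp x1 xv mulr1 !mulr0 add0r addr0.
- by rewrite yp y1 yv mulr1 !mulr0 !add0r.
Qed.

(** A basis meets P and is not contained in it. *)
Let basis_types T : T \in B ->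
  (exists r u w, [/\ r \in P, u \in U, w \in U & T = [set r; u; w]]) \/
  (exists r s u, [/\ r \in P, s \in P, u \in U & T = [set r; s; u]]).
Proof.
move=> TB; have PP u : u \in T -> u \notin P -> u \in U.
  by move=> uT uP; rewrite inE uP (inV TB).
have P0 : P != finset.set0 by apply/set0Pn; exists p.
have [r rP rT] := fibration_meets cfg fib P0 TB.
have /subsetPn[u uT uP] := not_in_fibre cfg fib isT TB.
have ur : u != r by apply: contraNneq uP => ->.
have [w TE] := set3_of_card (basis_card cfg TB) uT rT ur.
have wT : w \in T by rewrite TE !inE eqxx orbT.
have [wP|wP] := boolP (w \in P); [right; exists r, w, u | left; exists r, u, w].
  by split=> //; [exact: PP | rewrite TE setUC setUA setUC setUA setUAC].
by split; rewrite ?PP // TE [[set u; r]]setUC.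
Qed.

Lemma rank3_unimodular : unimodular_config G B.
Proof.
have [[xp x1 xv] [yp y1 yv]] := (XE, YE).
have [|||M [M' [W1 W2 W3 cone_PUU cone_PPU]]] :=
  @plane_nef 'I_N (fun r => r \in P) (fun u => u \in U) tri l x y L AX AY
    L0 lP lU0 _ _ _ pos_PUU span_PUU pos_PPU span_PPU unit_PUU unit_PPU
      positive_U
    section_U max_y p q v f1 f2 pq p1 q2 pP qP vU f1U f2U xp x1 xv yp y1 yv.
- by move=> i j k; rewrite /tri [[set i; j]]setUC.
- by move=> i j k; rewrite /tri setUAC.
- by move=> i j /distinct[_ _]; rewrite eqxx.
have cones T : T \in B ->
  [/\ in_cone_of G T (wvec 1 1 M), in_cone_of G T (wvec 1 0 M')
    & in_cone_of G T (wvec 0 0 1)].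
  move=> TB; case: (basis_types TB) => -[r [s [u [rP sP uU TE]]]];
    rewrite TE in TB *.
    by have [? ? ?] := cone_PUU r s u rP sP uU TB; split; apply: cone_of_scalar.
  by have [? ? ?] := cone_PPU r s u rP sP uU TB; split; apply: cone_of_scalar.
apply: (unimodular_of_dual
  (f := fun k : 'I_3 => nth 0
    [:: fvec 0 1 0; fvec 1 (-1) 0; fvec (- M') (M' - M) 1] k)
  (w := fun k : 'I_3 => nth 0 [:: wvec 1 1 M; wvec 1 0 M'; wvec 0 0 1] k)).
- by case=> [[|[|[|//]]] ?]; case=> [[|[|[|//]]] ?]; rewrite /= pairing; ring.
- by case=> [[|[|[|//]]] ?]; apply: wall_of_scalar.
- by case=> [[|[|[|//]]] ?] T /cones[].
Qed.

End Rank3.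

Lemma section_triple N d (V : {set 'I_N}) (G : 'M[int]_(N, d)) a B P phi p u :
  gale_config V G a B -> fibration V G B P phi -> d = 3 -> p \in P ->
    u \in V :\: P ->
  exists2 w, w \notin P & [set p; w; u] \in B.
Proof.
move=> cfg fib d3 pP uU; have [T [TB TP uT]] := section_through cfg fib pP uU.
have /setIP[pT _] : p \in T :&: P by rewrite TP set11.
have pu : p != u by apply: contraTneq uU => <-; rewrite inE pP.
have T3 : #|T| = 3 by rewrite (basis_card cfg TB).
have [w TE] := set3_of_card T3 pT uT pu.
have := T3; rewrite TE => /card_set3[_ pw _].
exists w; last by rewrite setUAC -TE.
apply: contraNN pw => wP; rewrite eq_sym -in_set1 -TP inE wP andbT TE.
by rewrite !inE eqxx orbT.
Qed.

(** If some basis contains two members of P, it also contains an element outside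
P, so the rank is 3; a basis through p and v that meets P in p alone provides
the direction f1, and one through q and v provides f2. *)
Theorem config_unimodular N d (V : {set 'I_N}) (G : 'M[int]_(N, d)) a B :
  (d <= 3)%N -> gale_config V G a B -> unimodular_config G B.
Proof.
elim: d V G a B => [|d IH] V G a B d3 cfg.
  exists 0, 0; split; last by case.
    by apply/matrixP=> -[].
  by case.
have [P [phi fib P0]] := fibration_ex cfg (ltn0Sn d).
have [/'forall_implyP meets_once|] := boolP [forall T in B, #|T :&: P| == 1%N].
  apply: (bundle_unimodular cfg fib) => [T /meets_once/cards1P //|V' G' a' B'].
  by apply: IH; apply: ltnW.
rewrite negb_forall => /existsP[T]; rewrite negb_imply => /andP[TB TP].
have T_d := basis_card cfg TB; have TV := subsetP (basis_sub cfg TB).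
have [r rP rT] := fibration_meets cfg fib P0 TB.
have /card_gt1P[p [q [pTP qTP pq]]] : (1 < #|T :&: P|)%N.
  rewrite ltn_neqAle eq_sym TP; apply/card_gt0P; exists r.
  by rewrite inE rT.
move: pTP qTP; rewrite !inE => /andP[pT pP] /andP[qT qP].
have d1 : (1 < d.+1)%N by rewrite -T_d; apply/card_gt1P; exists p, q.
have /subsetPn[v vT vP] := not_in_fibre cfg fib d1 TB.
have d2 : d = 2.
  apply/eqP; rewrite -eqSS eqn_leq d3 -T_d; apply/card_gt2P; exists p, q, v.
  by split=> //; split; rewrite // ?(eq_sym q); apply: contraNneq vP => ->.
subst d; have [k TE] := set3_of_card T_d pT qT pq.
have {k}TE : T = [set p; q; v].
  rewrite TE; move: vT; rewrite TE !inE => /orP[/orP[]|] /eqP e;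
    last by rewrite e.
    by rewrite e pP in vP.
  by rewrite e qP in vP.
have vU : v \in V :\: P by rewrite inE vP TV.
have [f1 f1P p1] := section_triple cfg fib (erefl 3) pP vU.
have [f2 f2P q2] := section_triple cfg fib (erefl 3) qP vU.
have [p_f1 p_v f1_v] := card_set3 (basis_card cfg p1).
have dual i : exists psi,
  {in [set p; f1; v], forall t, ev G psi t = (t == i)%:R}.
  exact: (basis_dual cfg (fun t => (t == i)%:R) p1).
have [X XE] := dual f1; have [Y YE] := dual v; rewrite TE in TB.
apply: (rank3_unimodular cfg fib (X := X) (Y := Y) TB p1 q2) => //; split.
- by rewrite XE ?inE ?eqxx // (negPf p_f1).
- by rewrite XE ?inE ?eqxx ?orbT.
- by rewrite XE ?inE ?eqxx ?orbT // eq_sym (negPf f1_v).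
- by rewrite YE ?inE ?eqxx // (negPf p_v).
- by rewrite YE ?inE ?eqxx ?orbT // (negPf f1_v).
- by rewrite YE ?inE ?eqxx ?orbT.
Qed.

(** * The configuration of a fan *)

Lemma lead_coef_ge0 (R : realType) (p : {poly R}) :
  (forall K : nat, exists2 k, (K <= k)%N & 0 <= p.[k%:R]) -> 0 <= lead_coef p.
Proof.
move=> pge0; rewrite leNgt; apply/negP => lt0.
have [|b bP] := @poly_pinfty_gt_lc R (- p);
  first by rewrite lead_coefN oppr_gt0.
have [k Kk] := pge0 (Num.bound `|b|).
rewrite leNgt => /negP; apply; rewrite -oppr_gt0 -hornerN.
apply: lt_le_trans (bP k%:R _); first by rewrite lead_coefN oppr_gt0.
by rewrite (le_trans (ler_norm _)) // ltW //
  (lt_le_trans (archi_boundP (normr_ge0 b))) // ler_nat.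
Qed.

Section Fan.
Variables (R : realType) (n : nat) (X : fan n).
Hypothesis smooth : smooth_fan R X.
Hypothesis complete : complete_fan R X.
Local Notation N := (nrays X).
Local Notation u := (rays X).

Lemma cone_basis S : S \in cones X -> exists (C : 'M[int]_n) (f : 'I_N -> 'I_n),
  [/\ C \in unitmx, {in S &, injective f}
    & {in S, forall i, row i u = row (f i) C}].
Proof.
by have [_ _ basis _] := smooth => /basis[C Cu [f finj fE]]; exists C, f.
Qed.

Lemma cone_span (S : {set 'I_N}) (C : 'M[int]_n) (f : 'I_N -> 'I_n)
  (w : 'rV_n) : C \in unitmx -> #|S| = n ->
  {in S &, injective f} -> {in S, forall i, row i u = row (f i) C} ->
  w = (\row_i (if i \in S then (w *m invmx C) 0 (f i) else 0)) *m u.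
Proof.
move=> Cu Sn finj fE; have fS : f @: S = [set: 'I_n].
  by apply/eqP; rewrite eqEcard finset.subsetT cardsT card_ord
    (card_in_imset finj) Sn leqnn.
rewrite -[LHS](mulmxKV Cu) !mulmx_sum_row [RHS](bigID (mem S)) /=.
rewrite [X in _ = _ + X]big1 ?addr0 => [|i /negPf iS];
  last by rewrite mxE iS scale0r.
rewrite (eq_bigl (mem (f @: S))) => [|j];
  last by rewrite -[RHS]/(j \in f @: S) fS inE.
rewrite big_imset //=.
by apply: eq_bigr => i iS; rewrite mxE iS fE.
Qed.

Lemma cone_dual S (z : 'I_N -> int) : S \in cones X ->
  exists m : 'rV[int]_n, {in S, forall i, (m *m u^T) 0 i = z i}.
Proof.
move=> /cone_basis[C [f [Cu finj fE]]].
pose e : 'rV[int]_n := \row_j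
  (if [pick i in S | f i == j] is Some i then z i else 0).
exists (e *m (invmx C)^T) => i iS.
have -> : (e *m (invmx C)^T *m u^T) 0 i = (e *m (row i u *m invmx C)^T) 0 0.
  rewrite -mulmxA -trmx_mul -row_mul [LHS]mxE [RHS]mxE; apply: eq_bigr => k _.
  by congr (_ * _); rewrite [LHS]mxE [RHS]mxE [RHS]mxE.
rewrite fE // -row_mul mulmxV // row1 mxE (bigD1 (f i)) //= big1 ?addr0.
  rewrite !mxE !eqxx mulr1; case: pickP => [j /andP[jS /eqP e']|/(_ i)].
    by rewrite (finj _ _ jS iS e').
  by rewrite iS eqxx.
by move=> j ji; rewrite !mxE /= (negPf ji) mulr0.
Qed.

(** k^n times a point that tends to v.  The entries of the correction are the
distinct powers of k below k^n, so a proper subspace contains only finitely many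
of these vectors. *)
Definition perturb (v : 'rV[int]_n) (k : nat) : 'rV[int]_n :=
  k%:R ^+ n *: v + \row_(i < n) k%:R ^+ i.

Lemma recurrent_cone v : exists2 S, S \in cones X &
  forall K, exists2 k, (K <= k)%N & in_cone S
    (map_mx intr (perturb v k) : 'rV[R]_n).
Proof.
apply: contrapT => no.
have /fin_all_exists[K KE] :
    forall S : {set 'I_N}, exists K : nat, S \in cones X ->
    forall k, (K <= k)%N -> ~ in_cone S (map_mx intr (perturb v k) : 'rV[R]_n).
  move=> S; have [SX|_] := boolP (S \in cones X); last by exists 0%N.
  apply: contrapT => noK; apply: no; exists S => // K.
  apply: contrapT => nok; apply: noK; exists K => _ k Kk vk; apply: nok.
  by exists k.
have [S SX] := complete (map_mx intr (perturb v (\max_S K S))).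
by apply: (KE S SX); apply: leq_bigmax.
Qed.

(** Infinitely many of the perturbations lie in one cone S.  The coordinates of
the perturbation with respect to the Z-basis that contains the rays of S are
polynomials in k with nonnegative values at these k.  A coordinate that does not
belong to a ray of S would vanish identically, so S has n rays; the coefficients
of k^n are the coordinates of v, and they are nonnegative. *)
Lemma max_cone_cover (v : 'rV[int]_n) : exists S, max_cone S /\
  exists s : 'rV[int]_N, [/\ supported S s, forall i, 0 <= s 0 i & v = s *m u].
Proof.
have [S SX rec] := recurrent_cone v; have [C [f [Cu finj fE]]] := cone_basis SX.
pose D := invmx C.
(* The j-th coordinate of the perturbation as a polynomial in k: v gives the
coefficient of k^n. *)
pose p j : {poly R} := \poly_(i < n.+1)
  (oapp (fun i' : 'I_n => D i' j) ((v *m D) 0 j) (insub i))%:~R.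
have pE j k : (p j).[k%:R] = ((perturb v k *m D) 0 j)%:~R.
  rewrite horner_poly big_ord_recr /= insubF ?ltnn //= mulmxDl -scalemxAl.
  rewrite [in RHS]mxE intrD addrC; congr (_ + _).
    by rewrite [in RHS]mxE intrM mulrC rmorphXn /= mulrz_nat.
  rewrite [in RHS]mxE rmorph_sum /=; apply: eq_bigr => i _.
  by rewrite mxE valK /= intrM mulrC rmorphXn /= mulrz_nat.
have uD i j : i \in S -> (u *m D) i j = (f i == j)%:R.
  move=> iS; have := row_mul i u D; rewrite fE // -row_mul mulmxV //.
  by move=> /rowP/(_ j); rewrite [LHS]mxE => ->; rewrite !mxE.
have coord (w : 'rV[int]_n) (c : 'rV[R]_N) j :
  (forall i, i \notin S -> c 0 i = 0) ->
    map_mx intr w = c *m raysK X R ->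
    ((w *m D) 0 j)%:~R = \sum_(i in S | f i == j) c 0 i.
  move=> sc wE; have -> : ((w *m D) 0 j)%:~R =
    (map_mx intr w *m map_mx intr D) 0 j :> R.
    by rewrite -map_mxM [RHS]mxE.
  rewrite wE -mulmxA /raysK -map_mxM mxE
    (bigID (fun i => (i \in S) && (f i == j))) /=.
  rewrite [X in _ + X]big1 ?addr0 => [|i]; last first.
    have [iS /= fij|/sc-> _] := boolP (i \in S); last by rewrite mul0r.
    by rewrite [map_mx _ _ _ _]mxE uD // (negPf fij) mulr0.
  by apply: eq_bigr => i /andP[iS fij];
    rewrite [map_mx _ _ _ _]mxE uD // fij mulr1.
have coord_ge0 j K : exists2 k, (K <= k)%N & 0 <= (p j).[k%:R].
  have [k Kk [c [c0 sc wE]]] := rec K; exists k; rewrite // pE (coord _ c) //.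
  by apply: sumr_ge0.
have fS j : exists2 i, i \in S & f i = j.
  have [/imsetP[i iS ->]|nfS] := boolP (j \in f @: S); first by exists i.
  (* This coordinate is 0 on the cone of S, so both signs are nonnegative. *)
  have coord_eq0 K : exists2 k, (K <= k)%N & 0 <= (- p j).[k%:R].
    have [k Kk [c [c0 sc wE]]] := rec K; exists k;
      rewrite // hornerN pE (coord _ c) //.
    rewrite big_pred0 ?oppr0 // => i; apply/negP => /andP[iS /eqP e].
    by case/negP: nfS; apply/imsetP; exists i.
  have pj0 : p j = 0.
    apply/eqP; rewrite -lead_coef_eq0 eq_le; apply/andP; split.
      by rewrite -oppr_ge0 -lead_coefN; apply: lead_coef_ge0.
    by apply: lead_coef_ge0.
  have D0 k : D k j = 0.
    have : (p j)`_k = 0 by rewrite pj0 coef0.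
    by rewrite coef_poly ltnS (ltnW (ltn_ord k)) valK /= => /eqP;
      rewrite intr_eq0 => /eqP.
  have /matrixP/(_ j j) := mulmxV Cu; rewrite !mxE eqxx big1 => [/eqP|k _].
    by rewrite eq_sym oner_eq0.
  by rewrite -/D D0 mulr0.
have Sn : #|S| = n.
  rewrite -(card_in_imset finj); apply/eqP;
    rewrite -[X in _ == X]card_ord -cardsT.
  apply/eqP; congr #|pred_of_set _|; apply/setP=> j; rewrite !inE.
  by have [i iS <-] := fS j; apply: imset_f.
exists S; split; first by rewrite /max_cone SX Sn eqxx.
exists (\row_i (if i \in S then (v *m D) 0 (f i) else 0)); split.
- by move=> i iS; rewrite mxE (negPf iS).
- move=> i; rewrite mxE; case: ifP => // iS.
  (* If the coefficient of k^n is not 0, it is the leading one. *)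
  have coefn : (p (f i))`_n = ((v *m D) 0 (f i))%:~R.
    by rewrite coef_poly ltnSn insubF ?ltnn.
  rewrite -(ler0z R) -coefn; have [->//|neq0] := eqVneq (p (f i))`_n 0.
  suff -> : n = (size (p (f i))).-1 by apply: lead_coef_ge0.
  apply/eqP; rewrite eqn_leq;
    have le := size_poly n.+1 _ : (size (p (f i)) <= n.+1)%N.
  have gt : (n < size (p (f i)))%N.
    by rewrite ltnNge; apply: contra neq0 => /leq_sizeP/(_ n (leqnn n)) ->.
  by case: (size _) le gt => //= m; rewrite !ltnS => -> ->.
- exact: cone_span.
Qed.
End Fan.

Lemma raysK_int n (X : fan n) : raysK X int = rays X.
Proof. by apply/matrixP=> i j; rewrite mxE intz. Qed.

Lemma clZ n (X : fan n) (K : comNzRingType) (c : K) (D : 'rV[K]_(nrays X)) :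
  cl (c *: D) = c *: cl D.
Proof. by rewrite -scale_cl. Qed.

Lemma cl_mul n (X : fan n) (K : comNzRingType) m (z : 'rV[K]_m)
  (A : 'M[K]_(m, nrays X)) :
  cl (z *m A) = \sum_k z 0 k *: cl (row k A).
Proof.
rewrite mulmx_sum_row; apply: (big_ind2 (fun D c => cl D = c)) =>
  [|D c D' c' <- <-|k _].
- by apply: (@addrI _ (cl 0)); rewrite -clD !addr0.
- exact: clD.
- exact: clZ.
Qed.

(** The exact sequence M -> Z^N -> Z^rho -> 0 as matrix identities, which
survive the base change to any ring: G is the projection Z^N -> Pic(X), S a
section, and M a partial inverse of the map m |-> div(m). *)
Record gale_dual n (X : fan n) rho (G : 'M[int]_(nrays X, rho))
  (S : 'M[int]_(rho, nrays X))
    (M : 'M[int]_(nrays X, n)) : Prop := GaleDual {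
  gale_section : S *m G = 1%:M;
  gale_rays : (rays X)^T *m G = 0;
  gale_exact : 1%:M = G *m S + M *m (rays X)^T }.

Lemma gale_ex n (X : fan n) rho : has_rank (Pic X int) rho ->
  exists G S M, @gale_dual n X rho G S M.
Proof.
case=> b bZ; have /fin_all_exists[g gE] : forall i, exists z : 'rV[int]_rho,
    cl (delta_mx 0 i) = \sum_k b k *~ z 0 k.
  by move=> i; have [z [zE _]] := bZ (cl (delta_mx 0 i)); exists z.
pose G : 'M[int]_(nrays X, rho) := \matrix_(i, k) g i 0 k.
pose S : 'M[int]_(rho, nrays X) := \matrix_(k, i) repr (b k) 0 i.
have rowS k : cl (row k S) = b k.
  by rewrite -[RHS]repr_cl; congr cl; apply/rowP=> i; rewrite !mxE.
have bE (z : 'rV[int]_rho) : cl (z *m S) = \sum_k b k *~ z 0 k.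
  by rewrite cl_mul; apply: eq_bigr => k _; rewrite rowS -scaler_int intz.
have GE D : cl D = \sum_k b k *~ (D *m G) 0 k :> Pic X int.
  rewrite -bE -mulmxA -[D in LHS]mulmx1 !cl_mul; apply: eq_bigr => i _;
    congr (_ *: _).
  rewrite row1 gE -bE row_mul; congr (cl (_ *m _)).
  by apply/rowP=> k; rewrite !mxE.
have uniq (z : 'rV[int]_rho) (D : 'rV[int]_(nrays X)) :
  cl D = \sum_k b k *~ z 0 k -> z = D *m G.
  by move=> e; have [y [_ yu]] := bZ (cl D); rewrite -(yu _ e) -(yu _ (GE D)).
have /fin_all_exists[m mE] : forall i, exists m : 'rV[int]_n,
    delta_mx 0 i - delta_mx 0 i *m G *m S = m *m (rays X)^T.
  move=> i; have /cl_eq[m mE] : cl (delta_mx 0 i) = cl (delta_mx 0 i *m G *m S).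
    by rewrite bE GE.
  by exists m; rewrite mE /divK raysK_int.
exists G, S, (\matrix_(i, j) m i 0 j); split.
- apply/row_matrixP => k; rewrite row_mul -(uniq (delta_mx 0 k)) ?row1 // rowS.
  rewrite (bigD1 k) //= big1 ?addr0 => [|l lk]; first by rewrite mxE !eqxx.
  by rewrite mxE (negPf lk) andbF mulr0z.
- apply/row_matrixP => k; rewrite row_mul row0; apply: esym; apply: uniq.
  transitivity (cl (0 : 'rV[int]_(nrays X))).
    apply/cl_eq; exists (delta_mx 0 k); rewrite subr0 /divK raysK_int.
    by rewrite -rowE.
  by rewrite GE; apply: eq_bigr => l _; rewrite mul0mx.
- apply/row_matrixP => i; rewrite linearD /= !row_mul row1.
  have -> : row i (\matrix_(i', j) m i' 0 j) = m i by apply/rowP=> j;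
    rewrite !mxE.
  by rewrite -mE -!rowE addrC subrK.
Qed.

Section Config.
Variables (R : realType) (n : nat) (X : fan n).
Hypothesis proj : smooth_projective R X.
Variables (rho : nat) (G : 'M[int]_(nrays X, rho)) (S : 'M[int]_(rho, nrays X))
    (M : 'M[int]_(nrays X, n)).
Hypothesis gG : gale_dual G S M.
Local Notation N := (nrays X).
Local Notation u := (rays X).

Let smooth : smooth_fan R X. Proof. by have [] := proj. Qed.
Let complete : complete_fan R X. Proof. by have [] := proj. Qed.

Lemma relation_functional (b : 'rV[int]_N) : b *m u = 0 ->
  forall i, ev G (S *m b^T) i = b 0 i.
Proof.
move=> b0 i; rewrite /ev mulmxA.
have -> : G *m S = 1%:M - M *m u^T by rewrite (gale_exact gG) addrK.
by rewrite mulmxBl mul1mx -mulmxA -trmx_mul b0 trmx0 mulmx0 subr0 mxE.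
Qed.

Lemma functional_relation (phi : 'cV[int]_rho) : (G *m phi)^T *m u = 0.
Proof.
by rewrite -[u]trmxK -trmx_mul mulmxA (gale_rays gG) mul0mx trmx0.
Qed.

Definition cobases : {set {set 'I_N}} := [set T | max_cone (~: T)].

Lemma max_cone_span T (w : 'rV[int]_n) : max_cone T ->
  exists2 c : 'rV[int]_N, supported T c & w = c *m u.
Proof.
case/andP=> TX /eqP Tn; have [C [f [Cu finj fE]]] := cone_basis smooth TX.
eexists; last exact: (cone_span w Cu Tn finj fE).
by move=> i iT; rewrite mxE (negPf iT).
Qed.

(** The vector a is the class of an ample divisor: the Cartier datum on a
maximal cone moves its divisor to one that is positive off the cone and zero on
it. *)
Lemma fan_config : exists a, gale_config [set: 'I_N] G a cobases.
Proof.
have [_ _ [D ampleD]] := proj.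
have principal0 (m : 'rV[int]_n) : m *m u^T *m G = 0.
  by rewrite -mulmxA (gale_rays gG) mulmx0.
exists (D *m G); split.
- by move=> T _; apply: finset.subsetT.
- move=> T w; rewrite inE => TB; have [TX _] := andP TB.
  have [m mE] := cone_dual smooth (fun i => (w *m S) 0 i) TX.
  exists (w *m S - m *m u^T).
    move=> i; rewrite -[i \notin T]finset.in_setC => /mE mi.
    by rewrite mxE [X in _ + X]mxE mi subrr.
  by rewrite mulmxBl principal0 subr0 -mulmxA (gale_section gG) mulmx1.
- move=> T z; rewrite inE => TB.
  pose c : 'rV[int]_N := \row_i (if i \in T then z i else 0).
  have [e se cE] := max_cone_span (c *m u) TB.
  have rel : (c - e) *m u = 0 by rewrite mulmxBl cE subrr.
  exists (S *m (c - e)^T) => i iT; rewrite relation_functional //.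
  by rewrite mxE [X in _ + X]mxE se ?inE ?iT // subr0 mxE iT.
- move=> T; rewrite inE => TB; have [m mE] := ampleD _ TB.
  exists (D + m *m u^T); split.
  + move=> i iT; have := mE i; rewrite inE iT /divK raysK_int => e.
    by rewrite [LHS]mxE e subrr.
  + move=> i iT; have := mE i; rewrite inE iT /divK raysK_int /= => lt.
    by rewrite [ltRHS]mxE -ltrBlDl sub0r.
  + by rewrite mulmxDl principal0 addr0.
- move=> z; pose c : 'rV[int]_N := \row_i z i.
  have [T [Tmax [s [sT s0 cE]]]] := max_cone_cover smooth complete (c *m u).
  have rel : (c - s) *m u = 0 by rewrite mulmxBl cE subrr.
  have evE i : ev G (S *m (c - s)^T) i = z i - s 0 i.
    by rewrite relation_functional // !mxE.
  exists (~: T), (S *m (c - s)^T); split.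
  + by rewrite inE finset.setCK.
  + by move=> i _; rewrite evE lerBlDr lerDl.
  + by move=> i; rewrite inE => /sT si; rewrite evE si subr0.
- move=> i _; have [T [Tmax [s [sT s0 iE]]]] :=
    max_cone_cover smooth complete (row i u).
  exists (~: T); rewrite ?inE ?finset.setCK // negbK.
  apply/negPn/negP => iT; have [single _ _ inter] := smooth.
  have [C [f [Cu _ fE]]] := cone_basis smooth (single i).
  have [TX _] := andP Tmax;
    have [] := inter [set i] T (single i) TX (map_mx intr (row i u)).
  + exists (delta_mx 0 i); split=> [j|j|].
    * by rewrite mxE ler0n.
    * by rewrite finset.in_set1 mxE eq_sym => /negPf; rewrite eq_sym => ->;
        rewrite andbF.
    * by rewrite -rowE map_row.
  + exists (map_mx intr s); split=> [j|j /sT|].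
    * by rewrite mxE ler0z.
    * by rewrite mxE => ->.
    * by rewrite iE map_mxM.
  move=> c [_ sc cE].
  have c0 : c = 0.
    apply/rowP=> j; rewrite mxE; apply: sc; rewrite !inE;
      apply/negP => /andP[/eqP -> ].
    by rewrite (negPf iT).
  have : row i u = 0.
    apply/rowP=> j; move/rowP/(_ j): cE; rewrite c0 mul0mx !mxE => /eqP.
    by rewrite intr_eq0 => /eqP.
  rewrite fE ?finset.set11 // => C0; have := mulmxV Cu.
  move/row_matrixP/(_ (f i));
    rewrite row_mul C0 mul0mx row1 => /rowP/(_ (f i)) /eqP.
  by rewrite !mxE !eqxx eq_sym oner_eq0.
Qed.

End Config.

(** * The nef cone and the Gongyo indices *)

Section NefCone.
Variables (R : realType) (n : nat) (X : fan n) (rho : nat).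
Variables (G : 'M[int]_(nrays X, rho)) (S : 'M[int]_(rho, nrays X))
  (M : 'M[int]_(nrays X, n)).
Hypothesis gG : gale_dual G S M.
Variables F W : 'M[int]_rho.
Hypothesis WF : W *m F = 1%:M.
Hypothesis walls : forall k, wall G (cobases X) (col k F).
Hypothesis cones : forall k T, T \in cobases X -> in_cone_of G T (row k W).
Local Notation N := (nrays X).

(** The values of the facets, that is the coordinates with respect to the
generators of the nef cone. *)
Definition coord (K : comNzRingType) (c : Pic X K) : 'rV[K]_rho :=
  repr c *m map_mx intr (G *m F).

Definition of_coord (K : comNzRingType) (z : 'rV[K]_rho) : Pic X K :=
  cl (z *m map_mx intr (W *m S)).

Definition nef_generator k : Pic X int := of_coord (delta_mx 0 k).

Lemma coord_cl (K : comNzRingType) (D : 'rV[K]_N) :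
  coord (cl D) = D *m map_mx intr (G *m F).
Proof.
have /cl_eq[m DE] := repr_cl (cl D).
apply/eqP; rewrite /coord -subr_eq0 -mulmxBl DE /divK /raysK -mulmxA map_trmx
  -map_mxM.
by rewrite mulmxA (gale_rays gG) mul0mx map_mx0 mulmx0.
Qed.

Lemma of_coordK (K : comNzRingType) : cancel (@of_coord K) (@coord K).
Proof.
move=> z; rewrite coord_cl -mulmxA -map_mxM -mulmxA [S *m _]mulmxA
  (gale_section gG).
by rewrite mul1mx WF map_mx1 mulmx1.
Qed.

Lemma coordK (K : comNzRingType) : cancel (@coord K) (@of_coord K).
Proof.
move=> c; rewrite -[RHS]repr_cl; apply: esym; apply/cl_eq.
rewrite /coord -mulmxA -map_mxM mulmxA -[G *m F *m W]mulmxA (mulmx1C WF) mulmx1.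
have -> : G *m S = 1%:M - M *m (rays X)^T by rewrite (gale_exact gG) addrK.
exists (repr c *m map_mx intr M).
rewrite map_mxB map_mx1 mulmxBr mulmx1 opprB addrCA subrr addr0.
by rewrite map_mxM /divK mulmxA map_trmx.
Qed.

Lemma coordD (K : comNzRingType) (c d : Pic X K) :
  coord (c + d) = coord c + coord d.
Proof. by rewrite -[c]repr_cl -[d]repr_cl -clD !coord_cl mulmxDl. Qed.

Lemma coordZ (K : comNzRingType) (t : K) (c : Pic X K) : coord (t *: c) = t *:
  coord c.
Proof. by rewrite -[c]repr_cl -clZ !coord_cl -scalemxAl. Qed.

Lemma coord0 (K : comNzRingType) : coord (0 : Pic X K) = 0.
Proof. by rewrite -(scale0r (0 : Pic X K)) coordZ scale0r. Qed.

Lemma coordN (K : comNzRingType) (c : Pic X K) : coord (- c) = - coord c.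
Proof. by rewrite -scaleN1r coordZ scaleN1r. Qed.

Lemma coord_sum (K : comNzRingType) (I : Type) (r : seq I) (E : I -> Pic X K) :
  coord (\sum_(i <- r) E i) = \sum_(i <- r) coord (E i).
Proof.
by elim/big_rec2: _ => [|i d c _ <-]; rewrite ?coord0 // coordD.
Qed.

Lemma coordMz (c : Pic X int) (z : int) : coord (c *~ z) = z *: coord c.
Proof. by rewrite -scaler_int intz coordZ. Qed.

Lemma coord_pic_map (K : comNzRingType) (c : Pic X int) :
  coord (pic_map K c) = map_mx intr (coord c).
Proof.
rewrite -[c]repr_cl pic_map_cl !coord_cl [RHS]map_mxM; congr (_ *m _).
by apply/matrixP=> i j; rewrite !mxE intz.
Qed.

Lemma coord_generator (K : comNzRingType) k :
  coord (pic_map K (nef_generator k)) = delta_mx 0 k.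
Proof.
rewrite coord_pic_map of_coordK; apply/rowP=> j; rewrite !mxE.
by case: (_ && _).
Qed.

Lemma coord_basis (K : comNzRingType) (c : Pic X K) :
  c = \sum_k coord c 0 k *: pic_map K (nef_generator k).
Proof.
apply: (can_inj (@coordK K)); rewrite coord_sum [LHS]row_sum_delta.
by apply: eq_bigr => k _; rewrite coordZ coord_generator.
Qed.

Lemma coord_basis_int (c : Pic X int) :
  c = \sum_k nef_generator k *~ coord c 0 k.
Proof.
apply: (can_inj (@coordK int)); rewrite coord_sum [LHS]row_sum_delta.
by apply: eq_bigr => k _; rewrite coordMz of_coordK.
Qed.

Lemma generator_Zbasis : Zbasis nef_generator.
Proof.
move=> c; exists (coord c); split; first exact: coord_basis_int.
move=> z cE; rewrite cE coord_sum [RHS]row_sum_delta.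
by apply: eq_bigr => k _; rewrite coordMz of_coordK.
Qed.

Lemma wall_curve k : invariant_curve ((G *m col k F)^T).
Proof.
have [tau [i [j [[itau jtau ij] iB jB tau0 [i1 j1]]]]] := walls k.
have valE t : (G *m col k F)^T 0 t = ev G (col k F) t by rewrite mxE.
have [Si Sj] : max_cone (~: (i |: tau)) /\ max_cone (~: (j |: tau)).
  by move: iB jB; rewrite !inE.
exists (~: (i |: tau)), (~: (j |: tau)); split; split=> //.
- have [_ /eqP c1] := andP Si; rewrite -[RHS]c1.
  have e : ~: (i |: tau) = j |: (~: (i |: tau) :&: ~: (j |: tau)).
    apply/setP=> t; rewrite !inE; have [->|tj] /= := eqVneq t j; last first.
      by case: (t == i); case: (t \in tau).
    by rewrite negb_or eq_sym ij.
  by rewrite [in RHS]e cardsU1 !inE eqxx andbF.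
- exact: functional_relation gG _.
- move=> t; rewrite !inE valE.
  have [->|ti] := eqVneq t i; first by rewrite i1.
  have [->|tj] := eqVneq t j; first by rewrite j1.
  by case: (t \in tau).
- move=> t; rewrite !inE valE negb_or !negbK => /andP[].
  case/orP=> [/eqP ->|tt _]; last exact: tau0.
  by rewrite (negPf ij) (negPf itau).
Qed.

(** A class with nonnegative coordinates lies in the simplicial cone of the
complement of S1, on which an invariant curve of the wall between S1 and S2 has
the values 0 and 1. *)
Lemma nef_coord (c : Pic X R) : @Nef n R X c <-> forall k, 0 <= coord c 0 k.
Proof.
have dotE (D : 'rV[R]_N) (b : 'rV[int]_N) :
  dot D b = (D *m map_mx intr (b^T)) 0 0.
  by rewrite mxE; apply: eq_bigr => i _; rewrite !mxE.
split=> [nefc k|c0 b [S1 [S2 [[S1m S2m _] [b0 b1 bout]]]]].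
  have := nefc _ (wall_curve k); rewrite /intersection dotE trmxK.
  by rewrite -col_mulmx -[X in _ -> 0 <= X]/((repr c *m _) 0 k) !mxE;
     congr (_ <= _); apply: eq_bigr => i _; rewrite !mxE.
rewrite /intersection dotE.
have -> : b^T = (G *m F) *m (W *m (S *m b^T)).
  rewrite mulmxA -[G *m F *m W]mulmxA (mulmx1C WF) mulmx1.
  by apply/colP=> i; rewrite -[RHS]/(ev G _ i) (relation_functional gG b0) mxE.
rewrite [map_mx _ _](map_mxM _ (G *m F)) (mulmxA (repr c)) -/(coord c)
  [leRHS]mxE.
apply: sumr_ge0 => k _; apply: mulr_ge0 => //.
have S1B : ~: S1 \in cobases X by rewrite inE setCK.
have [e [se e0 eE]] := cones k S1B.
rewrite mxE ler0z.
have -> : (W *m (S *m b^T)) k 0 = (row k W *m (S *m b^T)) 0 0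
  by rewrite -row_mul [RHS]mxE.
rewrite eE (eval_supp _ _ se); apply: sumr_ge0 => i; rewrite inE => iS1.
rewrite mulr_ge0 // (relation_functional gG b0).
have [iS2|iS2] := boolP (i \in S2); first by rewrite b1 // !inE iS2 iS1 orbT.
by rewrite bout // !inE negb_or iS1.
Qed.

Lemma nef_coord_int (c : Pic X int) : nef R c <-> forall k, 0 <= coord c 0 k.
Proof.
rewrite /nef; split=> [/nef_coord c0 k|c0].
  by have := c0 k; rewrite coord_pic_map mxE ler0z.
by apply/nef_coord => k; rewrite coord_pic_map mxE ler0z.
Qed.

(** Nef classes are those with nonnegative coordinates, so the extremal rays are
the coordinate axes.  For an extremal primitive g with positive k-th coordinate,
the k-th component of g is nef and so is its complement; hence g is a multiple
of the k-th generator, and primitivity makes the factor 1. *)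
Lemma nef_unimodular : unimodular (@pic_map n X R) (@Nef n R X).
Proof.
have inj := can_inj (@coordK R); have inj_int := can_inj (@coordK int).
split.
- move=> v; pose x : Pic X R := of_coord (\row_k Num.max 0 (coord v 0 k)).
  exists x, (x - v); split; last by rewrite opprB addrCA subrr addr0.
    by apply/nef_coord => k; rewrite of_coordK mxE le_max lexx.
  apply/nef_coord => k; rewrite coordD coordN of_coordK !mxE subr_ge0.
  by rewrite le_max lexx orbT.
- move=> v /nef_coord v0 /nef_coord v0'; apply: inj; rewrite coord0.
  apply/rowP => k; rewrite [RHS]mxE; apply/eqP; rewrite eq_le v0 andbT.
  by have := v0' k; rewrite coordN mxE oppr_ge0.
- exists rho, nef_generator => v; rewrite nef_coord; split=> [v0|[c c0 ->] k].
    by exists (fun k => coord v 0 k) => //; apply: coord_basis.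
  rewrite coord_sum summxE; apply: sumr_ge0 => j _.
  by rewrite coordZ coord_generator !mxE mulr_ge0 ?ler0n.
exists rho, nef_generator; split; first exact: generator_Zbasis.
have gen_neq0 (K : comNzRingType) k : pic_map K (nef_generator k) != 0.
  apply/negP => /eqP/(congr1 (@coord K)); rewrite coord_generator coord0.
  by move=> /rowP/(_ k) /eqP; rewrite !mxE !eqxx oner_eq0.
move=> g; split=> [[k ->]|[[g0 gprim] [Cg _ gext]]].
  split; first split.
  - apply/negP => /eqP/(congr1 (@coord int)); rewrite of_coordK coord0.
    by move=> /rowP/(_ k) /eqP; rewrite !mxE !eqxx oner_eq0.
  - move=> h m /(congr1 (@coord int)); rewrite pmulrn coordMz of_coordK.
    move=> /rowP/(_ k); rewrite !mxE !eqxx /= => e.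
    have := congr1 absz e; rewrite abszM absz_nat => /eqP.
    by rewrite eq_sym muln_eq1 => /andP[/eqP].
  - split; [|exact: gen_neq0|]; first by apply/nef_coord => j;
      rewrite coord_generator mxE ler0n.
    move=> x y /nef_coord x0 /nef_coord y0 e.
    exists (coord x 0 k) => //; apply: inj; rewrite coordZ coord_generator.
    have ej j : (delta_mx 0 k : 'rV[R]_rho) 0 j = coord x 0 j + coord y 0 j.
      by rewrite -coord_generator e coordD mxE.
    apply/rowP => j; rewrite [RHS]mxE [delta_mx _ _ _ _]mxE /=.
    have := ej j; rewrite mxE /=; have [->|jk] := eqVneq j k;
      first by rewrite mulr1.
    by rewrite mulr0 => /esym/eqP; rewrite paddr_eq0 // => /andP[/eqP].
have z0 := (nef_coord_int g).1 Cg.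
have [k zk] : exists k, 0 < coord g 0 k.
  apply: contrapT => no; case/eqP: g0; apply: inj_int; rewrite coord0.
  apply/rowP => k; rewrite [RHS]mxE; apply/eqP; rewrite eq_le z0 andbT leNgt.
  by apply/negP => zk; apply: no; exists k.
exists k; pose h : Pic X int := nef_generator k *~ coord g 0 k.
have coordh : coord h = coord g 0 k *: delta_mx 0 k
  by rewrite coordMz of_coordK.
have [t t0 ht] : exists2 t : R, 0 <= t & pic_map R h = t *: pic_map R g.
  apply: (gext _ (pic_map R g - pic_map R h));
    last by rewrite addrCA subrr addr0.
  - apply/nef_coord => j; rewrite coord_pic_map coordh mxE ler0z.
    by rewrite [(_ *: _ : 'rV__) _ _]mxE mulr_ge0 // mxE ler0n.
  - apply/nef_coord => j; rewrite coordD coordN !coord_pic_map coordh.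
    rewrite [leRHS]mxE [X in _ + X]mxE ![map_mx _ _ _ _]mxE subr_ge0 ler_int.
    rewrite [(_ *: _ : 'rV__) _ _]mxE [delta_mx _ _ _ _]mxE /=.
    by have [->|_] := eqVneq j k; rewrite ?mulr1 ?mulr0.
have e j : (coord h 0 j)%:~R = t * (coord g 0 j)%:~R.
  have := congr1 (@coord R) ht; rewrite coordZ !coord_pic_map => /rowP/(_ j).
  by rewrite !mxE.
have t1 : t = 1.
  have := e k; rewrite coordh [(_ *: _ : 'rV__) _ _]mxE
    [delta_mx _ _ _ _]mxE !eqxx mulr1 => /eqP.
  rewrite -subr_eq0 -{1}[_%:~R]mul1r -mulrBl mulf_eq0 intr_eq0 (gt_eqF zk) orbF.
  by rewrite subr_eq0 eq_sym => /eqP.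
have gh : g = h.
  apply: inj_int; apply/rowP => j; have := e j; rewrite t1 mul1r => /eqP.
  by rewrite eqr_int => /eqP.
have gm : g = nef_generator k *+ `|coord g 0 k|.
  by rewrite {1}gh /h pmulrn gez0_abs // ltW.
have z1 := gprim _ _ gm; by rewrite gm z1 mulr1n.
Qed.

(** The sum of the coordinates is at least 1 on every nonzero nef class, which
bounds the sum of the coefficients of any rational decomposition. *)
Lemma tau_sum (D : Pic X int) : nef R D ->
  let s := ((\sum_k coord D 0 k)%:~R : R)%:E in tauZ R D = s /\ tauQ R D = s.
Proof.
move=> /nef_coord_int z0 s; have inj_rat := can_inj (@coordK rat).
have Zs : @decompositionsZ n R X D s.
  pose A := [set k | 0 < coord D 0 k].
  have out k : k \notin A -> coord D 0 k = 0.
    by rewrite inE -leNgt => zk; apply/eqP; rewrite eq_le zk z0.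
  exists #|A|, (fun i => coord D 0 (enum_val i)),
    (fun i => nef_generator (enum_val i)).
  split.
  - move=> i; split.
      apply/negP => /eqP/(congr1 (@coord int)); rewrite of_coordK coord0.
      by move=> /rowP/(_ (enum_val i)) /eqP; rewrite !mxE !eqxx oner_eq0.
    by apply/nef_coord_int => j; rewrite of_coordK mxE ler0n.
  - by move=> i; have := enum_valP i; rewrite inE.
  - rewrite {1}[D]coord_basis_int (bigID (mem A)) /= [X in _ + X]big1 ?addr0.
      by rewrite big_enum_val.
    by move=> k /out ->; rewrite mulr0z.
  - rewrite /s (bigID (mem A)) /= [X in _ + X]big1 ?addr0;
      last by move=> k /out.
    by rewrite big_enum_val.
have sub : (@decompositionsZ n R X D `<=` @decompositionsQ n R X D)%classic.
  move=> x [r [b [E [nefE b0 DE ->]]]].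
  exists r, (fun i => (b i)%:~R), E; split=> //.
  - by move=> i; rewrite ltr0z.
  - apply: inj_rat; rewrite coord_sum coord_pic_map DE coord_sum.
    rewrite [LHS](raddf_sum (@map_mx _ _ intr 1 rho)) /=; apply: eq_bigr => i _.
    by rewrite coordZ coord_pic_map coordMz map_mxZ.
  - by rewrite -[X in ratr X](rmorph_sum intr) ratr_int.
have ubQ : ubound (@decompositionsQ n R X D) s.
  move=> x [r [b [E [nefE b0 DE ->]]]];
    rewrite lee_fin /s -(ratr_int R) ler_rat.
  have -> : (\sum_k coord D 0 k)%:~R = \sum_i b i *
    (\sum_k coord (E i) 0 k)%:~R :> rat.
    have e k : (coord D 0 k)%:~R = \sum_i b i * (coord (E i) 0 k)%:~R :> rat.
      have := congr1 (@coord rat) DE;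
        rewrite coord_sum coord_pic_map => /rowP/(_ k).
      rewrite mxE summxE => ->; apply: eq_bigr => i _.
      by rewrite coordZ coord_pic_map [LHS]mxE [map_mx _ _ _ _]mxE.
    rewrite rmorph_sum /= (eq_bigr _ (fun k _ => e k)) exchange_big /=.
    by apply: eq_bigr => i _; rewrite rmorph_sum /= mulr_sumr.
  apply: ler_sum => i _; rewrite ler_peMr ?(ltW (b0 i)) //.
  rewrite -[1]/(1%:~R) ler_int -gtz0_ge1.
  have [E0 /nef_coord_int Ege] := nefE i.
  rewrite lt_neqAle sumr_ge0 ?andbT //; apply: contra E0 => /eqP/esym/eqP.
  rewrite psumr_eq0 // => /allP Ek0; apply/eqP/(can_inj (@coordK int)).
  rewrite coord0; apply/rowP => k; rewrite [RHS]mxE; apply/eqP.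
  exact: (Ek0 k (mem_index_enum k)).
have tauQs : tauQ R D = s.
  apply/eqP; rewrite eq_le ge_ereal_sup //= ereal_sup_ubound //; exact: sub.
split=> //; apply/eqP; rewrite eq_le ereal_sup_ubound // andbT -tauQs.
exact: ereal_sup_le sub.
Qed.

End NefCone.

Theorem theorem4p2 (R : realType) (n : nat) (X : fan n)
    (hX : smooth_projective R X)
    (rho : nat) (hrho : has_rank (Pic X int) rho) (rho_le3 : (rho <= 3)%N) :
  [/\ unimodular (@pic_map n X R) (@Nef n R X),
      forall D : Pic X int, D != 0 -> nef R D ->
        tauZ R D = tauQ R D /\ delta R D = 0%E
    & weak_fano R X -> tauZ R (antican X) = tauQ R (antican X)].
Proof.
have [G [S [M gG]]] := gale_ex hrho.
have [a cfg] := fan_config hX gG.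
have [F [W [WF walls cones]]] := config_unimodular rho_le3 cfg.
have tau := tau_sum gG WF walls cones.
split; first exact: (nef_unimodular R gG WF walls cones).
- by move=> D _ /tau[tZ tQ]; rewrite /delta tZ tQ subee.
- by case=> /tau[-> ->].
Qed.
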